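(* Let $\mu\in\mathrm{Sz}^c$. Then there exists a set $\Lambda\subseteq\mathbb{N}$ with lower density $\underline{\mathrm{d}}(\Lambda)=0$ such that $E(\Lambda)$ is dense in $L^2(\mathbb{T},\mu)$.
   Context: Conventions: $\mathbb{N}=\{1,2,3,\dots\}$, $\mathbb{T}$ is the complex unit circle (identified with $[0,2\pi)$), $\mathrm{d}m=\frac{\mathrm{d}\theta}{2\pi}$ is normalized Lebesgue measure on $\mathbb{T}$. $\mathcal{P}$ is the set of all probability measures on $\mathbb{T}$ with infinite support. Each $\mu\in\mathcal{P}$ has a Lebesgue decomposition $\mathrm{d}\mu=w\,\mathrm{d}m+\mathrm{d}\mu_s$ with $\mu_s$ singular with respect to $m$. $\mathrm{Sz}$ is the set of all $\mu\in\mathcal{P}$ with $\int_0^{2\pi}\log(w(\theta))\,\mathrm{d}\theta>-\infty$, and $\mathrm{Sz}^c:=\mathcal{P}\setminus\mathrm{Sz}$ (i.e. the integral equals $-\infty$). For $\Lambda\subseteq\mathbb{N}$, $E(\Lambda)$ is the complex linear span of the functions $z\mapsto z^\lambda$ on $\mathbb{T}$, $\lambda\in\Lambda$, and the lower density is $\underline{\mathrm{d}}(\Lambda):=\liminf_{N\to\infty}\frac{|\Lambda\cap\{1,\dots,N\}|}{N}$. *)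

(* Defs.v *)
From HB Require Import structures.
From mathcomp Require Import all_boot all_order all_algebra.
From mathcomp Require Import finmap.
From mathcomp Require Import all_classical all_reals all_analysis.
From mathcomp Require Export complex.

Set Implicit Arguments.
Unset Strict Implicit.
Unset Printing Implicit Defensive.

Import Order.TTheory GRing.Theory Num.Theory.
Import ComplexField.Normc.
Import numFieldNormedType.Exports.

Local Open Scope classical_set_scope.
Local Open Scope ring_scope.

(* The unit circle is identified with [0, 2pi[ through t |-> e^(it). Measures
   on the circle are Borel measures on the real line carried by [0, 2pi[, and
   functions on the circle are functions of the angle, whose values outside
   [0, 2pi[ are immaterial. *)
Definition angles {R : realType} : set R := `[0, 2 * pi[%classic.

Definition expi {R : realType} (t : R) : R[i] := Complex (cos t) (sin t).

Lemma measurable_angles {R : realType} :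
  measurable (angles : set (measurableTypeR R)).
Proof. exact: measurable_itv. Qed.

Lemma inv_2pi_ge0 {R : realType} : 0 <= (2 * pi : R)^-1.
Proof. by rewrite invr_ge0 mulr_ge0 ?ler0n ?pi_ge0. Qed.

(* dm = dt / 2pi *)
Definition circle_lebesgue (R : realType) :
    {measure set (measurableTypeR R) -> \bar R} :=
  mscale (NngNum (@inv_2pi_ge0 R)) (mrestr lebesgue_measure measurable_angles).

(* Topological support: neighbourhoods are taken in the circle, i.e. for the
   chordal distance |e^(is) - e^(it)|, so that 0 and 2pi are glued. *)
Definition circle_support {R : realType} (mu : set R -> \bar R) : set R :=
  [set t | angles t /\ forall e : R, 0 < e ->
    (0 < mu [set s | angles s /\ (normc (expi s - expi t) < e)%R])%E].

Definition class_P {R : realType} : set (probability (measurableTypeR R) R) :=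
  [set mu | mu angles = 1%E /\ infinite_set (circle_support mu)].

Definition mutually_singular d (T : measurableType d) (R : realType)
    (mu nu : set T -> \bar R) : Prop :=
  exists S : set T, [/\ measurable S, mu (~` S) = 0%E & nu S = 0%E].

Definition lebesgue_decomposition {R : realType} (mu : set R -> \bar R)
    (w : R -> R) (mus : {measure set (measurableTypeR R) -> \bar R}) : Prop :=
  [/\ measurable_fun setT (w : measurableTypeR R -> measurableTypeR R),
      forall t, 0 <= w t,
      mutually_singular mus (circle_lebesgue R) &
      forall A : set (measurableTypeR R), measurable A ->
        mu A = (\int[circle_lebesgue R]_(t in A) (w t)%:E + mus A)%E].

(* lne is the extended logarithm, with lne 0 = -oo. *)
Definition class_Sz {R : realType} : set (probability (measurableTypeR R) R) :=
  [set mu | class_P mu /\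
    exists w mus, lebesgue_decomposition mu w mus /\
      (-oo < \int[lebesgue_measure]_(t in angles) lne (w t)%:E)%E].

Definition class_Szc {R : realType} : set (probability (measurableTypeR R) R) :=
  class_P `\` class_Sz.

Definition L2_norm {R : realType}
    (mu : {measure set (measurableTypeR R) -> \bar R}) (f : R -> R[i]) : \bar R :=
  ('N[mu]_2%:E [EFin \o (fun t => normc (f t))])%E.

Definition L2 {R : realType} (mu : {measure set (measurableTypeR R) -> \bar R}) :
    set (R -> R[i]) :=
  [set f | [/\
    measurable_fun setT ((fun t => complex.Re (f t)) : measurableTypeR R -> measurableTypeR R),
    measurable_fun setT ((fun t => complex.Im (f t)) : measurableTypeR R -> measurableTypeR R)
    & (L2_norm mu f < +oo)%E]].

Definition L2_dense {R : realType}
    (mu : {measure set (measurableTypeR R) -> \bar R}) (E : set (R -> R[i])) : Prop :=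
  E `<=` L2 mu /\
  forall f, L2 mu f -> forall e : R, 0 < e ->
    exists2 g, E g & (L2_norm mu (fun t => f t - g t)%R < e%:E)%E.

Definition monomial_span {R : realType} (Lambda : set nat) : set (R -> R[i]) :=
  [set f | exists (s : seq nat) (c : nat -> R[i]),
    (forall l, l \in s -> Lambda l) /\
    f = (fun t => \sum_(l <- s) c l * expi t ^+ l)].

(* The term of index N = 0 is 0 / 0 = 0; it does not affect the liminf. *)
Definition lower_density {R : realType} (Lambda : set nat) : R :=
  limn_inf (fun N : nat =>
    #|` fset_set (Lambda `&` [set k | (1 <= k <= N)%N])|%:R / N%:R).

(* Main.v *)
Require Import Defs.
From HB Require Import structures.
From mathcomp Require Import all_boot all_order all_algebra.
From mathcomp Require Import finmap.
From mathcomp Require Import all_classical all_reals all_analysis.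
From mathcomp Require Import measurable_realfun ring lra.

(* By Szego's theorem the distance from 1 to the span of z, z^2, ... in L^2(mu)
   vanishes when the integral of log w is -oo. For T = Re P with P a polynomial,
   the polynomials (1 + (P - P(0)) / 2n)^n take the value 1 at 0 and have squared
   modulus at most exp(T - Re P(0) + o(1)) on the circle, so the squared distance
   is at most exp(- int T dm) int e^T dmu. Trigonometric polynomials approximate
   every bounded Borel function f boundedly in L^1(mu + m), because the sets whose
   indicator can be so approximated form a sigma-algebra containing the half-lines;
   hence the bound holds for f in place of T. Take f = min(n, (log w)^-) off an
   m-null set carrying the singular part and f = 0 on it: int e^f dmu <= 3, while
   int f dm -> +oo.

   Multiplying by powers of z, every z^k with k an integer is a limit of polynomials
   divisible by z^N, for each N. Choosing finite blocks of exponents [s_j, M_j[ such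
   that block j approximates z^k to precision 1/(j+1) for |k| <= j, with s_(j+1)
   larger than (j+1) M_j, gives an exponent set of lower density 0 whose span is
   dense. *)

Set Implicit Arguments.
Unset Strict Implicit.
Unset Printing Implicit Defensive.

Import Order.TTheory GRing.Theory Num.Theory.
Import ComplexField.Normc.
Import numFieldNormedType.Exports.

Local Open Scope classical_set_scope.
Local Open Scope ring_scope.

(** * Trigonometric polynomials *)

(** [m] is the sum of its restrictions to [D] and to the complement: the second vanishes on [D], the
    first outside it. *)
Lemma ge0_integral_mrestr d (T : measurableType d) (R : realType)
    (m : {measure set T -> \bar R}) (D : set T) (mD : measurable D)
    (f : T -> \bar R) :
  measurable_fun setT f -> (forall x, (0 <= f x)%E) ->
  (\int[mrestr m mD]_x f x = \int[m]_(x in D) f x)%E.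
Proof.
move=> mf f0; have mDc : measurable (~` D) by exact: measurableC.
have mfD : measurable_fun D f by exact: measurable_funTS.
rewrite (@eq_measure_integral _ _ _ _ (measure_add (mrestr m mD) (mrestr m mDc)) m);
  last first.
  move=> A mA _; transitivity (mrestr m mD A + mrestr m mDc A)%E; last first.
    exact/esym/measure_addE.
  rewrite /mrestr/= -measureU; [|exact: measurableI..|].
    by rewrite -setIUr setUv setIT.
  by rewrite setIACA setICr setI0.
rewrite ge0_integral_measure_add//.
rewrite [X in (_ + X)%E]null_set_integral// ?adde0; last first.
  by apply: etrans (measure0 m); congr (m _); exact: setICr.
rewrite [LHS](@ge0_negligible_integral _ _ _ _ _ (~` D))//.
  by rewrite setDE setCK setTI.
by apply: etrans (measure0 m); congr (m _); exact: setICl.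
Qed.

Section Circle.
Context {R : realType}.
Implicit Types (P Q : {poly R[i]}) (t : R).

Lemma ReD (x y : R[i]) : complex.Re (x + y) = complex.Re x + complex.Re y.
Proof. by case: x; case: y. Qed.

Lemma mulcE (a b c d : R) :
  Complex a b * Complex c d = Complex (a * c - b * d) (a * d + b * c).
Proof. by []. Qed.

Lemma conjcE (a b : R) : (Complex a b)^* = Complex a (- b).
Proof. by []. Qed.

Lemma ImD (x y : R[i]) : complex.Im (x + y) = complex.Im x + complex.Im y.
Proof. by case: x; case: y. Qed.

Lemma expi_exp t k : expi t ^+ k = Complex (cos (k%:R * t)) (sin (k%:R * t)).
Proof.
elim: k => [|k IH]; first by rewrite expr0 mul0r cos0 sin0.
rewrite exprS IH /expi -[k.+1]add1n natrD mulrDl mul1r cosD sinD.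
by rewrite /GRing.mul /=; congr Complex; rewrite addrC // ; ring.
Qed.

Lemma expi2pi : expi (2 * pi : R) = 1.
Proof. by rewrite /expi mulr_natl cos2pi sin2pi. Qed.

(* The real trigonometric polynomials, as real parts on the circle of
   polynomials in z = e^(it). *)
Definition trig (T : R -> R) : Prop :=
  exists P, T = fun t => complex.Re P.[expi t].

(** Additive induction: a polynomial is a sum of monomials, and the empty sum is the monomial with
    [c = 0], so no separate zero case arises. *)
Lemma trig_ind (Phi : (R -> R) -> Prop) :
  (forall (c : R[i]) k, Phi (fun t => complex.Re (c * expi t ^+ k))) ->
  (forall f g, Phi f -> Phi g -> Phi (fun t => f t + g t)) ->
  forall P, Phi (fun t => complex.Re P.[expi t]).
Proof.
move=> Phim PhiD P.
have -> : (fun t => complex.Re P.[expi t]) =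
  fun t => complex.Re (\sum_(i < size P) P`_i * expi t ^+ i).
  by apply/funext => t; rewrite horner_coef.
elim: (size P) => [|n IH].
  have -> : (fun t => complex.Re (\sum_(i < 0) P`_i * expi t ^+ i)) =
    fun t => complex.Re (0 * expi t ^+ 0).
    by apply/funext => t; rewrite big_ord0 mul0r.
  exact: Phim.
have -> : (fun t => complex.Re (\sum_(i < n.+1) P`_i * expi t ^+ i)) =
  fun t => complex.Re (\sum_(i < n) P`_i * expi t ^+ i)
           + complex.Re (P`_n * expi t ^+ n).
  by apply/funext => t; rewrite big_ord_recr /= ReD.
exact: PhiD.
Qed.

Lemma trigD f g : trig f -> trig g -> trig (fun t => f t + g t).
Proof.
move=> [P ->] [Q ->]; exists (P + Q).
by apply/funext => t; rewrite hornerD ReD.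
Qed.

Lemma trig_monomial (c : R[i]) k : trig (fun t => complex.Re (c * expi t ^+ k)).
Proof. by exists (c *: 'X^k); apply/funext => t; rewrite hornerZ hornerXn. Qed.

Lemma trig_cst (c : R) : trig (fun=> c).
Proof. by exists (Complex c 0)%:P; apply/funext => t; rewrite hornerC. Qed.

Lemma expi_mulC t : expi t * (expi t)^* = 1.
Proof.
rewrite /expi /GRing.mul /= mulrN opprK -!expr2 cos2Dsin2.
by rewrite mulrN mulrC addNr.
Qed.

Lemma Re_conj (x : R[i]) : complex.Re x^* = complex.Re x.
Proof. by case: x. Qed.

(** The real part is invariant under conjugation, which exchanges [j] and [k]. For j <= k,
    conjugating and cancelling z^j against its conjugate on the circle leaves a monomial of degree k
    - j. *)
Lemma trig_laurent (c : R[i]) j k :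
  trig (fun t => complex.Re (c * expi t ^+ j * (expi t ^+ k)^*)).
Proof.
wlog jk : c j k / (j <= k)%N => [wlg|].
  case: (leqP j k) => [/wlg//|/ltnW/(wlg c^*)].
  congr trig; apply/funext => t.
  by rewrite -[LHS]Re_conj !rmorphM/= !conjCK mulrAC.
have -> : (fun t => complex.Re (c * expi t ^+ j * (expi t ^+ k)^*)) =
          (fun t => complex.Re (c^* * expi t ^+ (k - j))); last exact: trig_monomial.
apply/funext => t; rewrite -[LHS]Re_conj !rmorphM/= conjCK -{1}(subnK jk) exprD.
rewrite mulrC -!mulrA mulrC !mulrA -[_ * c^* * _]mulrA mulrC.
by rewrite (mulrCA _ c^*) rmorphXn -exprMn expi_mulC expr1n mulr1 mulrC.
Qed.

(** By bilinearity both factors may be real parts of monomials a and b. Then Re a Re b is half the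
    sum of Re (a b) and Re (a conj b), and the latter is covered by [trig_laurent]. *)
Lemma trigM f g : trig f -> trig g -> trig (fun t => f t * g t).
Proof.
move=> [P ->] [Q ->].
apply: (trig_ind (Phi := fun f => trig (fun t => f t * complex.Re Q.[expi t])))
  => [c k|{}f {}g Hf Hg]; last first.
  under eq_fun do rewrite mulrDl.
  exact: trigD.
apply: (trig_ind (Phi := fun g => trig (fun t => complex.Re (c * expi t ^+ k) * g t)))
  => [d j|{}f {}g Hf Hg]; last first.
  under eq_fun do rewrite mulrDr.
  exact: trigD.
have -> : (fun t => complex.Re (c * expi t ^+ k) * complex.Re (d * expi t ^+ j)) =
  (fun t => complex.Re (2%:R^-1 * (c * d) * expi t ^+ (k + j)) +
            complex.Re ((2%:R^-1 * (c * d^*)) * expi t ^+ k * (expi t ^+ j)^*)).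
  apply/funext => t; rewrite exprD.
  move: (expi t ^+ k) (expi t ^+ j) c d => [a1 a2] [b1 b2] [c1 c2] [d1 d2].
  have -> : 2%:R^-1 = Complex (2^-1 : R) 0.
    by apply: (mulfI (x := 2%:R)); rewrite ?pnatr_eq0// mulfV ?pnatr_eq0//;
       rewrite mulr2n /GRing.mul /GRing.add/=; congr Complex; lra.
  by rewrite !conjcE !mulcE /=; field.
by apply: trigD; [exact: trig_monomial|exact: trig_laurent].
Qed.

Lemma trigN f : trig f -> trig (fun t => - f t).
Proof.
move=> /(trigM (trig_cst (-1))); congr trig.
by apply/funext => t; rewrite mulN1r.
Qed.

Lemma trigB f g : trig f -> trig g -> trig (fun t => f t - g t).
Proof. by move=> ? ?; apply: trigD => //; exact: trigN. Qed.

Lemma trigX f n : trig f -> trig (fun t => f t ^+ n).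
Proof.
move=> tf; elim: n => [|n IH]; first exact: trig_cst.
by under eq_fun do rewrite exprS; exact: trigM.
Qed.

Lemma trig_cos : trig cos.
Proof.
exists 'X; apply/funext => t; by rewrite hornerX.
Qed.

Lemma trig_sin : trig sin.
Proof.
have := trig_monomial (Complex 0 (-1)) 1; congr trig.
by apply/funext => t; rewrite expr1 /= mul0r mulN1r opprK add0r.
Qed.

Lemma continuous_trig f : trig f -> continuous f.
Proof.
move=> [P ->]; apply: (trig_ind (Phi := fun f => continuous f)).
  move=> [a b] k t.
  have -> : (fun t => complex.Re (Complex a b * expi t ^+ k)) =
    (fun t => a * cos (k%:R * t) - b * sin (k%:R * t)).
    by apply/funext => s; rewrite expi_exp.
  have kt : (fun t : R => k%:R * t) @ t --> k%:R * t by apply: cvgMr; exact: cvg_id.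
  apply: cvgB; apply: cvgMr.
    by apply: (continuous_comp kt); exact: continuous_cos.
  by apply: (continuous_comp kt); exact: continuous_sin.
by move=> g h cg ch t; apply: cvgD; [exact: cg|exact: ch].
Qed.

Lemma measurable_trig f : trig f ->
  measurable_fun setT (f : measurableTypeR R -> measurableTypeR R).
Proof. by move=> /continuous_trig; exact: continuous_measurable_fun. Qed.

(** Only the constant coefficient yields a non-periodic term, linear in [t]; this gives the
    increment over one period. *)
Lemma trig_antiderivative P : exists F : R -> R,
  (forall t, is_derive t (1 : R) F (complex.Re P.[expi t])) /\
  F (2 * pi) - F 0 = 2 * pi * complex.Re P.[0].
Proof.
(* Generalised to z^k P so that induction along Horner's scheme closes: z^k (P z + c) = z^(k+1) P +
   c z^k. *)
suff H k : exists F : R -> R,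
  (forall t, is_derive t (1 : R) F (complex.Re (expi t ^+ k * P.[expi t]))) /\
  F (2 * pi) - F 0 = 2 * pi * complex.Re (0 ^+ k * P.[0]).
  have [F [HF eF]] := H 0; exists F; split=> [t|]; last by rewrite eF mul1r.
  by have := HF t; rewrite mul1r.
elim/poly_ind: P k => [|P [a b] IH] k.
  exists (cst 0); split=> [t|]; last by rewrite horner0 mulr0 /= mulr0 subrr.
  by rewrite horner0 mulr0; exact: is_derive_cst.
have [F [HF eF]] := IH k.+1.
have [G [HG eG]] : exists G : R -> R,
  (forall t, is_derive t (1 : R) G (complex.Re (expi t ^+ k * Complex a b))) /\
  G (2 * pi) - G 0 = 2 * pi * complex.Re (0 ^+ k * Complex a b).
  case: k {IH F HF eF} => [|k].
    exists (fun t => a * t); split=> [t|].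
      rewrite mul1r /=. apply: is_derive_eq. by rewrite /GRing.scale/= mulr1.
    by rewrite expr0 mul1r /= mulr0 subr0 mulrC.
  have k0 : k.+1%:R != 0 :> R by rewrite pnatr_eq0.
  exists (fun t => k.+1%:R^-1 * (a * sin (k.+1%:R * t) + b * cos (k.+1%:R * t))).
  split=> [t|].
    apply: is_derive_eq.
    by rewrite expi_exp mulcE /= /GRing.scale /=; field.
  rewrite exprS mul0r mul0r /= mulr0.
  have := expi_exp (2 * pi) k.+1; rewrite expi2pi expr1n => -[<- <-].
  rewrite mulr0 cos0 sin0. by rewrite !mulr0 subrr.
exists (fun t => F t + G t); split=> [t|].
  have := is_deriveD (HF t) (HG t).
  by rewrite -ReD hornerD hornerC hornerMX mulrDr exprSr -mulrA [expi t * _]mulrC.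
rewrite opprD addrACA eF eG -mulrDr -ReD hornerD hornerC hornerMX.
by rewrite exprS !mul0r mulr0 !add0r.
Qed.

Lemma integral_circle_lebesgue (f : R -> \bar R) :
  measurable_fun setT (f : measurableTypeR R -> \bar R) -> (forall t, (0 <= f t)%E) ->
  (\int[circle_lebesgue R]_t f t =
    ((2 * pi)^-1)%:E * \int[lebesgue_measure]_(t in angles) f t)%E.
Proof.
move=> mf f0; rewrite ge0_integral_mscale//=.
by congr (_ * _)%E; exact: ge0_integral_mrestr.
Qed.

(** Mean value property, read off from the increment of an antiderivative over one period. *)
Lemma trig_mean P : (forall t, 0 <= complex.Re P.[expi t]) ->
  (\int[circle_lebesgue R]_t (complex.Re P.[expi t])%:E = (complex.Re P.[0])%:E)%E.
Proof.
move=> P0; have tP : trig (fun t => complex.Re P.[expi t]) by exists P.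
have pi20 : 0 < 2 * pi :> R by rewrite mulr_gt0// pi_gt0.
rewrite integral_circle_lebesgue//; last first.
  by apply/measurable_EFinP; exact: measurable_trig.
rewrite /angles integral_itv_bndo_bndc; last first.
  by apply: measurable_funTS; apply/measurable_EFinP; exact: measurable_trig.
have [F [HF eF]] := trig_antiderivative P.
have dF t : derivable F t 1 by have [] := HF t.
have cF : continuous F.
  by move=> t; apply: differentiable_continuous; apply/derivable1_diffP.
rewrite (continuous_FTC2 (F := F))//.
- rewrite -EFinB eF -EFinM mulrA mulVf ?mul1r//; exact: lt0r_neq0.
- by apply: continuous_subspaceT; exact: continuous_trig.
- split; first by move=> t _; exact: dF.
  + by apply: cvg_at_right_filter; exact: cF.
  + by apply: cvg_at_left_filter; exact: cF.
- by move=> t _; rewrite derive1E; have [_ ->] := HF t.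
Qed.

Lemma circle_lebesgueT : circle_lebesgue R setT = 1%E.
Proof.
rewrite /circle_lebesgue/= /mscale/= /mrestr setTI /angles lebesgue_measure_itv/=.
rewrite lte_fin mulr_gt0 ?pi_gt0// sube0 -EFinM mulVf//.
by rewrite mulf_neq0// gt_eqF// pi_gt0.
Qed.

Lemma circle_lebesgue_fin : fin_num_fun (circle_lebesgue R).
Proof.
move=> A mA; rewrite ge0_fin_numE//.
apply: (@le_lt_trans _ _ (circle_lebesgue R setT)).
  by apply: le_measure => //; rewrite inE.
by rewrite circle_lebesgueT ltry.
Qed.

End Circle.

(** * Approximation of bounded Borel functions *)

Section RealLimits.
Context {R : realType}.

Lemma bernoulli_ge (y : R) n : 0 <= y <= 1 -> 1 - n%:R * y <= (1 - y) ^+ n.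
Proof.
move=> /andP[y0 y1]; elim: n => [|n IH]; first by rewrite mul0r subr0.
rewrite exprS -[n.+1]addn1 natrD.
have : (1 - y) * (1 - n%:R * y) <= (1 - y) * (1 - y) ^+ n.
  by rewrite ler_wpM2l// subr_ge0.
have : 0 <= n%:R * y * y by rewrite !mulr_ge0.
nra.
Qed.

(** Bernoulli gives n y <= (1 + y)^n, and (1 - y)^n (1 + y)^n = (1 - y^2)^n <= 1. *)
Lemma bernoulli_le (y : R) n : 0 <= y <= 1 -> (1 - y) ^+ n * (n%:R * y) <= 1.
Proof.
move=> /andP[y0 y1].
have h : 1 + n%:R * y <= (1 + y) ^+ n.
  elim: n => [|n IH]; first by rewrite mul0r addr0.
  rewrite exprS -[n.+1]addn1 natrD.
  have : (1 + y) * (1 + n%:R * y) <= (1 + y) * (1 + y) ^+ n.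
    by rewrite ler_wpM2l// addr_ge0.
  have : 0 <= n%:R * y * y by rewrite !mulr_ge0.
  nra.
have h1 : 0 <= (1 - y) ^+ n by rewrite exprn_ge0// subr_ge0.
apply: (@le_trans _ _ ((1 - y) ^+ n * (1 + y) ^+ n)).
  by rewrite ler_wpM2l// (le_trans _ h)// lerDr.
rewrite -exprMn exprn_ile1//; nra.
Qed.

(** 1 - (1 - x^n)^(2^n) is a step polynomial known from proofs of the Stone-Weierstrass theorem.
    Bernoulli's inequality bounds it by (2x)^n, which tends to 0 for x < 1/2. *)
Lemma cvg_small_power (x : R) : 0 <= x <= 1 -> x < 2^-1 ->
  (1 - (1 - x ^+ n) ^+ (2 ^ n)) @[n --> \oo] --> (0 : R).
Proof.
move=> /andP[x0 x1] x2.
have xn n : 0 <= x ^+ n <= 1 by rewrite exprn_ge0// exprn_ile1.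
apply: (@squeeze_cvgr _ _ _ _ (fun=> 0) (fun n => (2 * x) ^+ n)).
- near=> n; apply/andP; split.
    have /andP[? ?] := xn n.
    by rewrite subr_ge0 exprn_ile1// ?subr_ge0// lerBlDr lerDl.
  by rewrite exprMn -natrX; have := bernoulli_ge (2 ^ n) (xn n); lra.
- exact: cvg_cst.
- by apply: cvg_expr; rewrite ger0_norm; lra.
Unshelve. all: by end_near. Qed.

(** [bernoulli_le] with y = x^n bounds (1 - x^n)^(2^n) by (2x)^(-n), which tends to 0 for x >
    1/2. *)
Lemma cvg_large_power (x : R) : 0 <= x <= 1 -> 2^-1 < x ->
  (1 - (1 - x ^+ n) ^+ (2 ^ n)) @[n --> \oo] --> (1 : R).
Proof.
move=> /andP[x0 x1] x2.
have xn n : 0 <= x ^+ n <= 1 by rewrite exprn_ge0// exprn_ile1.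
rewrite -[X in _ --> X]subr0; apply: cvgB; first exact: cvg_cst.
apply: (@squeeze_cvgr _ _ _ _ (fun=> 0) (fun n => (2 * x)^-1 ^+ n)).
- near=> n; apply/andP; split.
    by rewrite exprn_ge0// subr_ge0; have /andP[] := xn n.
  have p : 0 < (2 * x) ^+ n by rewrite exprn_gt0//; lra.
  rewrite exprVn -[leRHS]mul1r ler_pdivlMr//.
  by rewrite exprMn -natrX; exact: bernoulli_le.
- exact: cvg_cst.
- have x2' : 1 < 2 * x by lra.
  by apply: cvg_expr; rewrite ger0_norm ?invr_ge0 ?invf_lt1//; lra.
Unshelve. all: by end_near. Qed.

End RealLimits.

Section Approximation.
Context {R : realType}.
Variable nu : {finite_measure set (measurableTypeR R) -> \bar R}.
Hypothesis nu_angles : nu (~` angles) = 0%E.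

Let mfun (f : R -> R) :=
  measurable_fun setT (f : measurableTypeR R -> measurableTypeR R).

(** The bounds on [T] allow products to be approximated factor by factor, and later keep exp(M T)
    below exp(M). *)
Definition trig_approx (f : R -> R) : Prop :=
  [/\ mfun f, forall t, 0 <= f t <= 1 &
    forall e : R, 0 < e -> exists2 T, trig T /\ (forall t, 0 <= T t <= 1) &
      (\int[nu]_t `|f t - T t|%:E < e%:E)%E].

Let le_int (f g h : R -> R) : mfun f -> mfun g -> mfun h ->
  (forall t, `|f t| <= `|g t| + `|h t|) ->
  (\int[nu]_t `|f t|%:E <= \int[nu]_t `|g t|%:E + \int[nu]_t `|h t|%:E)%E.
Proof.
move=> mf mg mh fgh; rewrite -ge0_integralD//; last 2 first.
- by apply/measurable_EFinP; exact: measurableT_comp.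
- by apply/measurable_EFinP; exact: measurableT_comp.
apply: ge0_le_integral => //.
- by apply/measurable_EFinP; exact: measurableT_comp.
- apply: emeasurable_funD; apply/measurable_EFinP; exact: measurableT_comp.
- by move=> t _; rewrite -EFinD lee_fin.
Qed.

Let trig_mfun T : trig T -> mfun T. Proof. exact: measurable_trig. Qed.

Lemma trig_approx_trig T : trig T -> (forall t, 0 <= T t <= 1) -> trig_approx T.
Proof.
move=> tT T01; split=> //; first exact: trig_mfun.
move=> e e0; exists T => //.
under eq_integral do rewrite subrr normr0.
by rewrite integral0 lte_fin.
Qed.

(** Dominated convergence with the constant 1, integrable because [nu] is finite. Convergence on
    [angles] suffices since [nu] vanishes outside. *)
Lemma trig_approx_cvg (f : R -> R) (f_ : nat -> R -> R) : mfun f ->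
  (forall t, 0 <= f t <= 1) -> (forall n, trig_approx (f_ n)) ->
  (forall t, angles t -> f_ n t @[n --> \oo] --> f t) -> trig_approx f.
Proof.
move=> mf f01 af_ f_f; split=> // e e0.
have mf_ n : mfun (f_ n) by have [] := af_ n.
have ae_angles (Q : R -> Prop) : (forall t, angles t -> Q t) -> {ae nu, forall t, Q t}.
  move=> HQ; exists (~` angles); split=> //.
    exact: measurableC (measurable_angles).
  by move=> t /=; apply: contra_not => /HQ.
have [|||||_ cv _] := @dominated_convergence _ _ _ nu setT measurableT
  (fun n t => (f_ n t)%:E) (fun t => (f t)%:E) (cst 1%E).
- by move=> n; apply/measurable_EFinP; exact: mf_.
- exact/measurable_EFinP.
- apply: ae_angles => t at_ _; apply: cvg_EFin; first exact: nearW.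
  exact: f_f.
- by apply: finite_measure_integrable_cst.
- apply: aeW => t n _; have [_ /(_ t)/andP[h0 h1] _] := af_ n.
  by rewrite /= lee_fin ger0_norm.
have : \forall n \near \oo, (\int[nu]_t `|(f_ n t)%:E - (f t)%:E| < (e / 2)%:E)%E.
  by apply: (cv [set u | (u < (e / 2)%:E)%E]); apply: open_ereal_lt'; rewrite lte_fin divr_gt0.
move=> [n _ /(_ n (leqnn n))/= hn].
have [_ _ /(_ (e / 2))[|T [tT T01] hT]] := af_ n; first by rewrite divr_gt0.
exists T => //; have mT := trig_mfun tT; have mfn := mf_ n.
apply: (@le_lt_trans _ _ (\int[nu]_t `|f_ n t - f t|%:E +
  \int[nu]_t `|f_ n t - T t|%:E)%E).
  apply: le_int; [exact: measurable_funB..|].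
  move=> t; rewrite (_ : f t - T t = (f_ n t - T t) - (f_ n t - f t)); last by ring.
  by rewrite [leRHS]addrC; exact: ler_normB.
rewrite [e]splitr EFinD; apply: lteD => //.
Qed.

Lemma trig_approx_eq f g : mfun f -> (forall t, 0 <= f t <= 1) ->
  (forall t, angles t -> g t = f t) -> trig_approx g -> trig_approx f.
Proof.
move=> mf f01 fg ag; apply: (trig_approx_cvg (f_ := fun=> g)) => //.
by move=> t /fg ->; exact: cvg_cst.
Qed.

Lemma trig_approxC f : trig_approx f -> trig_approx (fun t => 1 - f t).
Proof.
move=> [mf f01 af]; split=> [|t|e /af[T [tT T01] hT]].
- by apply: measurable_funB => //; exact: measurable_cst.
- by have := f01 t; lra.
- exists (fun t => 1 - T t).
    split; first by apply: trigB => //; exact: trig_cst.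
    by move=> t; have := T01 t; lra.
  rewrite (eq_integral (fun t : measurableTypeR R => `|f t - T t|%:E))// => t _.
  by rewrite -normrN; congr (`|_|%:E); ring.
Qed.

Lemma trig_approxM f g : trig_approx f -> trig_approx g ->
  trig_approx (fun t => f t * g t).
Proof.
move=> [mf f01 af] [mg g01 ag]; split=> [|t|e e0].
- exact: measurable_funM.
- by have := f01 t; have := g01 t; nra.
- have [|T [tT T01] hT] := af (e / 2); first by rewrite divr_gt0.
  have [|S [tS S01] hS] := ag (e / 2); first by rewrite divr_gt0.
  exists (fun t => T t * S t).
    split; first exact: trigM.
    by move=> t; have := T01 t; have := S01 t; nra.
  apply: (@le_lt_trans _ _ (\int[nu]_t `|f t - T t|%:E +
    \int[nu]_t `|g t - S t|%:E)%E); last by rewrite [e]splitr EFinD; exact: lteD.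
  have mT := trig_mfun tT; have mS := trig_mfun tS.
  apply: le_int; [|exact: measurable_funB..|].
    by apply: measurable_funB; exact: measurable_funM.
  move=> t; rewrite (_ : _ - _ = (f t - T t) * g t + T t * (g t - S t)); last by ring.
  apply: le_trans (ler_normD _ _) _; rewrite !normrM lerD//.
    by rewrite -[leRHS]mulr1 ler_wpM2l// ger0_norm; have /andP[] := g01 t.
  by rewrite -[leRHS]mul1r ler_wpM2r// ger0_norm; have /andP[] := T01 t.
Qed.

Lemma trig_approx_mean f g : trig_approx f -> trig_approx g ->
  trig_approx (fun t => (f t + g t) / 2).
Proof.
move=> [mf f01 af] [mg g01 ag]; split=> [|t|e e0].
- by apply: measurable_funM => //; exact: measurable_funD.
- by have := f01 t; have := g01 t; lra.
- have [|T [tT T01] hT] := af (e / 2); first by rewrite divr_gt0.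
  have [|S [tS S01] hS] := ag (e / 2); first by rewrite divr_gt0.
  exists (fun t => (T t + S t) / 2).
    split; first by apply: trigM (trig_cst _); exact: trigD.
    by move=> t; have := T01 t; have := S01 t; lra.
  apply: (@le_lt_trans _ _ (\int[nu]_t `|f t - T t|%:E +
    \int[nu]_t `|g t - S t|%:E)%E); last by rewrite [e]splitr EFinD; exact: lteD.
  have mT := trig_mfun tT; have mS := trig_mfun tS.
  apply: le_int; [|exact: measurable_funB..|].
    by apply: measurable_funB; apply: measurable_funM => //; exact: measurable_funD.
  move=> t; rewrite (_ : _ - _ = 2^-1 * (f t - T t) + 2^-1 * (g t - S t)); last by field.
  apply: le_trans (ler_normD _ _) _; rewrite !normrM ger0_norm//.
  by have := normr_ge0 (f t - T t); have := normr_ge0 (g t - S t); lra.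
Qed.

(** The function [v] crosses 1/2 exactly where [u] crosses [c], so the step polynomials in [v]
    converge to the indicator off {u = c}. The factor 1 - (1 - w)^n is 0 on {u = c} and tends to 1
    elsewhere, which settles the boundary. *)
Lemma trig_approx_gt u c : trig u -> (forall t, -1 <= u t <= 1) -> -1 <= c <= 1 ->
  trig_approx (\1_[set t | c < u t]).
Proof.
move=> tu u1 c1.
pose v t := (u t - c + 2) / 4; pose w t := ((u t - c) / 2) ^+ 2.
have v01 t : 0 <= v t <= 1 by have := u1 t; rewrite /v; lra.
have w01 t : 0 <= w t <= 1.
  have : -1 <= (u t - c) / 2 <= 1 by have := u1 t; lra.
  by rewrite /w sqr_ge0 /= expr2; set x := _ / 2; nra.
have tuc : trig (fun t => u t - c) by apply: trigB => //; exact: trig_cst.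
have tv : trig v.
  by apply: trigM (trig_cst _); apply: trigD => //; exact: trig_cst.
have tw : trig w by apply: trigX; apply: trigM (trig_cst _).
have C f : trig f -> trig (fun t => 1 - f t) by apply: trigB; exact: trig_cst.
have B01 (x : R) n : 0 <= x <= 1 -> 0 <= x ^+ n <= 1.
  by move=> /andP[? ?]; rewrite exprn_ge0// exprn_ile1.
have S01 (x : R) : 0 <= x <= 1 -> 0 <= 1 - x <= 1 by lra.
apply: (trig_approx_cvg (f_ := fun n t =>
  (1 - (1 - v t ^+ n) ^+ (2 ^ n)) * (1 - (1 - w t) ^+ n))).
- apply: measurable_indic; rewrite -[X in measurable X]setTI.
  rewrite (_ : [set t | c < u t] = u @^-1` `]c, +oo[); last first.
    by apply/seteqP; split=> t /=; rewrite in_itv/= andbT.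
  exact: trig_mfun.
- by move=> t; rewrite indicE; case: (_ \in _); rewrite ?lexx ?ler01.
- move=> n; apply: trig_approxM; apply: trig_approx_trig.
  + by apply: (C); apply: trigX; apply: (C); exact: trigX.
  + by move=> t; apply: (S01); apply: (B01); apply: (S01); exact: B01.
  + by apply: (C); apply: trigX; exact: C.
  + by move=> t; apply: (S01); apply: (B01); exact: S01.
move=> t _; rewrite indicE.
have w0 : 0 < w t -> (1 - (1 - w t) ^+ n) @[n --> \oo] --> (1 : R).
  move=> w0; rewrite -[X in _ --> X]subr0; apply: cvgB; first exact: cvg_cst.
  by apply: cvg_expr; rewrite ger0_norm; have := w01 t; lra.
have [ct|tc|ct] := ltgtP c (u t).
- rewrite mem_set//= -[X in _ --> X]mulr1; apply: cvgM.
    by apply: cvg_large_power => //; rewrite /v; lra.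
  by apply: w0; rewrite /w exprn_even_gt0//=; lra.
- rewrite memNset/=; last by apply/negP; rewrite -leNgt ltW.
  rewrite -[X in _ --> X](mul0r (1 : R)); apply: cvgM.
    by apply: cvg_small_power => //; rewrite /v; lra.
  by apply: w0; rewrite /w exprn_even_gt0//=; lra.
- rewrite memNset/=; last by rewrite ct ltxx.
  rewrite (_ : (fun n => _) = fun=> 0); first exact: cvg_cst.
  apply/funext => n.
  by rewrite /w ct subrr mul0r expr0n/= subr0 expr1n subrr mulr0.
Qed.

Lemma trig_approx_setC A : trig_approx (\1_A) -> trig_approx (\1_(~` A)).
Proof.
move=> /trig_approxC; congr trig_approx; apply/funext => t.
by rewrite !indicE in_setC; case: (t \in A); rewrite /= ?subrr ?subr0.
Qed.

Lemma trig_approx_setI A B : trig_approx (\1_A) -> trig_approx (\1_B) ->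
  trig_approx (\1_(A `&` B)).
Proof.
move=> aA aB; have := trig_approxM aA aB; congr trig_approx; apply/funext => t.
by rewrite !indicE in_setI; case: (t \in A); rewrite /= ?mul0r ?mul1r.
Qed.

Lemma trig_approx_setU A B : trig_approx (\1_A) -> trig_approx (\1_B) ->
  trig_approx (\1_(A `|` B)).
Proof.
move=> aA aB; rewrite -[A `|` B]setCK setCU.
by apply: trig_approx_setC; apply: trig_approx_setI; exact: trig_approx_setC.
Qed.

Let indic01 (A : set R) t : 0 <= (\1_A t : R) <= 1.
Proof. by rewrite indicE; case: (_ \in _); rewrite ?lexx ?ler01. Qed.

Lemma trig_approx_bigcup (F : nat -> set R) :
  (forall n, measurable (F n : set (measurableTypeR R))) ->
  (forall n, trig_approx (\1_(F n))) -> trig_approx (\1_(\bigcup_n F n)).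
Proof.
move=> mF aF; apply: (trig_approx_cvg (f_ := fun n => \1_(\big[setU/set0]_(i < n) F i))).
- by apply: measurable_indic; exact: bigcupT_measurable.
- exact: indic01.
- elim=> [|n IH]; last by rewrite big_ord_recr /=; exact: trig_approx_setU.
  rewrite big_ord0 indic0; apply: trig_approx_trig; first exact: trig_cst.
  by move=> t; rewrite lexx ler01.
move=> t _; have [[N _ FN]|nF] := pselect ((\bigcup_n F n) t).
  apply: cvg_near_cst; near=> n; rewrite !indicE [in RHS]mem_set; last by exists N.
  rewrite mem_set// -bigcup_mkord; exists N => //=.
  by near: n; exact: nbhs_infty_gt.
apply: cvg_near_cst; near=> n; rewrite !indicE [in RHS]memNset// memNset//.
by rewrite -bigcup_mkord => -[i _ Fi]; apply: nF; exists i.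
Unshelve. all: by end_near. Qed.

Lemma angles_sin_lt0 (t : R) : angles t -> (sin t < 0) = (pi < t).
Proof.
rewrite /angles /= in_itv /= => /andP[t0 t2].
have [tpi|tpi] := leP t pi.
  by apply/negbTE; rewrite -leNgt; apply: sin_ge0_pi; rewrite t0.
rewrite -[t](subrK pi) sinDpi oppr_lt0; apply: sin_gt0_pi.
by rewrite subr_gt0 tpi /=; lra.
Qed.

Lemma cos_2piB (t : R) : cos (2 * pi - t) = cos t.
Proof. by rewrite addrC mulr_natl cosD2pi cosN. Qed.

(** On [angles], sin t < 0 means t > pi, while cos decreases on [0, pi] and increases on [pi, 2 pi].
    Hence t > a is a Boolean combination of conditions sin t < 0 and a comparison of cos t with cos
    a; for a outside [0, 2 pi[ the indicator is constant. *)
Lemma trig_approx_ray a : trig_approx (\1_(`]a, +oo[ : set R)).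
Proof.
have maR : mfun (\1_(`]a, +oo[ : set R)) by exact: measurable_indic.
have cst01 (c : R) : 0 <= c <= 1 -> trig_approx (fun=> c).
  by move=> c01; apply: trig_approx_trig => //; exact: trig_cst.
have aS : trig_approx (\1_[set t : R | sin t < 0]).
  have := @trig_approx_gt (fun t => - sin t) 0 (trigN trig_sin).
  rewrite (_ : [set t : R | 0 < - sin t] = [set t : R | sin t < 0]); last first.
    by apply/seteqP; split=> t /=; rewrite oppr_gt0.
  apply; last by lra.
  by move=> t; have := sin_geN1 t; have := sin_le1 t; lra.
have aC c : -1 <= c <= 1 -> trig_approx (\1_[set t : R | cos t < c]).
  move=> c1; have := @trig_approx_gt (fun t => - cos t) (- c) (trigN trig_cos).
  rewrite (_ : [set t : R | - c < - cos t] = [set t : R | cos t < c]); last first.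
    by apply/seteqP; split=> t /=; rewrite ltrN2.
  apply; last by lra.
  by move=> t; have := cos_geN1 t; have := cos_le1 t; lra.
have c1 (t : R) : -1 <= cos t <= 1 by rewrite cos_geN1 cos_le1.
have pi0 : 0 < pi :> R := pi_gt0 R.
have [a0|a0] := ltP a 0.
  apply: (@trig_approx_eq _ (fun=> 1)) => //; last by apply: cst01; rewrite lexx ler01.
  move=> t; rewrite /angles /= in_itv /= => /andP[t0 _].
  by rewrite indicE mem_set//= in_itv/= andbT (lt_le_trans a0).
have [api|api] := ltP a pi.
  apply: (@trig_approx_eq _ (\1_([set t : R | sin t < 0] `|`
    ([set t : R | cos t < cos a] `&` ~` [set t : R | sin t < 0])))) => //.
    move=> t At; rewrite !indicE; congr (_%:R); congr nat_of_bool.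
    apply/idP/idP; rewrite !in_setE /= angles_sin_lt0// in_itv/= andbT.
      move=> [|[ca /negP]]; first exact: lt_trans.
      rewrite -leNgt => tpi; rewrite -ltr_cos// in_itv/= ?a0 ?(ltW api)// tpi andbT.
      by move: At; rewrite /angles/= in_itv/= => /andP[].
    move=> aT; have [tpi|tpi] := ltP pi t; [by left|right; split=> //].
    by rewrite ltr_cos ?in_itv/= ?a0 ?(ltW api)// tpi (le_trans a0 (ltW aT)).
  apply: trig_approx_setU => //; apply: trig_approx_setI; first exact: aC.
  exact: trig_approx_setC.
have [a2|a2] := leP (2 * pi) a.
  apply: (@trig_approx_eq _ (fun=> 0)) => //; last by apply: cst01; rewrite lexx ler01.
  move=> t; rewrite /angles /= in_itv /= => /andP[_ t2].
  by rewrite indicE memNset//= in_itv/= andbT; apply/negP; rewrite -leNgt (le_trans (ltW t2)).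
apply: (@trig_approx_eq _ (\1_([set t : R | sin t < 0] `&` [set t | cos a < cos t]))) => //.
  move=> t At; rewrite !indicE; congr (_%:R); congr nat_of_bool.
  move: (At); rewrite {1}/angles /= in_itv /= => /andP[t0 t2].
  have cc : pi < t -> (cos a < cos t) = (a < t).
    move=> pit; rewrite -(cos_2piB a) -(cos_2piB t) ltr_cos ?in_itv/=; [lra| |].
      by apply/andP; split; lra.
    by apply/andP; split; lra.
  apply/idP/idP; rewrite !in_setE /= angles_sin_lt0// in_itv/= andbT.
    by move=> [/cc ->].
  move=> aT; have pit : pi < t by exact: le_lt_trans aT.
  by rewrite cc.
apply: trig_approx_setI => //; apply: trig_approx_gt => //; exact: trig_cos.
Qed.

Lemma trig_approx_indic (A : set (measurableTypeR R)) :
  measurable A -> trig_approx (\1_A : R -> R).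
Proof.
(* Measurability is carried along because [trig_approx_bigcup] asks for it. *)
move=> mA; suff [] : (measurable `&` [set B : set R | trig_approx (\1_B : R -> R)]) A by [].
have : (@RGenOInfty.G R).-sigma.-measurable A by rewrite -RGenOInfty.measurableE.
apply: smallest_sub; last first.
  move=> _ [a ->]; split; first exact: measurable_itv.
  exact: trig_approx_ray.
split.
- split; first exact: measurable0.
  rewrite /= indic0; apply: trig_approx_trig; first exact: trig_cst.
  by move=> t; rewrite lexx ler01.
- move=> B [mB aB]; rewrite setTD; split; first exact: measurableC.
  exact: trig_approx_setC.
- move=> F FB; split; first by apply: bigcupT_measurable => n; have [] := FB n.
  by apply: trig_approx_bigcup => n; have [] := FB n.
Qed.

Lemma trig_approx_bounded f : mfun f -> (forall t, 0 <= f t <= 1) -> trig_approx f.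
Proof.
move=> mf f01.
(* Binary digits: f = (d + f') / 2 with d the indicator of f >= 1/2 *)
have approx n : forall g, mfun g -> (forall t, 0 <= g t <= 1) ->
    exists2 h, trig_approx h & forall t, `|h t - g t| <= 2^-1 ^+ n.
  elim: n => [|n IH] g mg g01.
    exists (fun=> 0).
      apply: trig_approx_trig; first exact: trig_cst.
      by move=> t; rewrite lexx ler01.
    by move=> t; rewrite sub0r normrN expr0 ger0_norm; have /andP[] := g01 t.
  pose A := [set t : measurableTypeR R | 2^-1 <= g t].
  have mA : measurable A.
    rewrite -[X in measurable X]setTI (_ : A = g @^-1` `[2^-1, +oo[); first exact: mg.
    by apply/seteqP; split=> t /=; rewrite in_itv/= andbT.
  have [|t|h ah gh] := IH (fun t => 2 * g t - \1_A t).
  - apply: measurable_funB; last exact: measurable_indic.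
    by apply: measurable_funM => //; exact: measurable_cst.
  - have := g01 t; rewrite indicE; have [|gt] := leP 2^-1 (g t).
      by move=> gt; rewrite mem_set//=; lra.
    by rewrite memNset/=; [lra|apply/negP; rewrite -ltNge].
  exists (fun t => (\1_A t + h t) / 2).
    by apply: trig_approx_mean => //; exact: trig_approx_indic.
  move=> t; have := gh t; rewrite exprS.
  rewrite (_ : _ / 2 - g t = 2^-1 * (h t - (2 * g t - \1_A t))); last by field.
  by rewrite normrM ger0_norm// ler_pM2l.
have /choice[h_ h_P] : forall n, exists h, trig_approx h /\
    forall t, `|h t - f t| <= 2^-1 ^+ n.
  by move=> n; have [h ? ?] := approx n f mf f01; exists h.
apply: (trig_approx_cvg (f_ := h_)) => //; first by move=> n; have [] := h_P n.
move=> t _; apply/cvgrPdist_le => /= e e0.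
have : (2^-1 : R) ^+ n @[n --> \oo] --> (0 : R).
  by apply: cvg_expr; rewrite ger0_norm ?invf_lt1 ?ltr1n.
move=> /cvgr0_norm_le /(_ _ e0); apply: filterS => n.
rewrite ger0_norm ?exprn_ge0// => ne; rewrite distrC.
by apply: le_trans ne; have [_] := h_P n.
Qed.

End Approximation.

(** * The upper bound in Szego's theorem *)

(** Makes one approximation valid in L^1 of two measures at once, and supplies a common dominating
    measure for the Lebesgue decomposition. *)
Lemma finite_measure_add d (T : measurableType d) (R : realType)
    (m1 m2 : {measure set T -> \bar R}) : fin_num_fun m1 -> fin_num_fun m2 ->
  exists nu : {finite_measure set T -> \bar R},
    (forall A, nu A = m1 A + m2 A)%E /\
    (forall f : T -> \bar R, measurable_fun setT f -> (forall x, 0 <= f x)%E ->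
      \int[nu]_x f x = \int[m1]_x f x + \int[m2]_x f x)%E.
Proof.
move=> f1 f2; pose nu0 := msum (fun n => if n is 0%N then m1 else m2) 2.
have nuE A : nu0 A = (m1 A + m2 A)%E by exact: measure_addE.
have nu_fin : fin_num_fun nu0.
  by move=> A mA; rewrite nuE fin_numD (f1 _ mA) (f2 _ mA).
pose nu : {finite_measure set T -> \bar R} :=
  HB.pack nu0 (Measure_isFinite.Build _ _ _ nu0 nu_fin).
exists nu; split=> // f mf f0.
exact: ge0_integral_measure_add.
Qed.

Section SzegoUpperBound.
Context {R : realType}.
Implicit Types (P Q : {poly R[i]}) (t : R).

(** The squared modulus with values in [R]. Along a polynomial in e^(it) it is again a real
    trigonometric polynomial. *)
Definition nsq (z : R[i]) : R := complex.Re z ^+ 2 + complex.Im z ^+ 2.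

Lemma nsq_ge0 z : 0 <= nsq z.
Proof. by rewrite addr_ge0// sqr_ge0. Qed.

Lemma nsqM z w : nsq (z * w) = nsq z * nsq w.
Proof. by case: z => a b; case: w => c d; rewrite mulcE /nsq /=; ring. Qed.

Lemma nsqX z n : nsq (z ^+ n) = nsq z ^+ n.
Proof.
elim: n => [|n IH]; first by rewrite /nsq /= expr1n expr0n addr0.
by rewrite !exprS nsqM IH.
Qed.

Lemma nsq1D w : nsq (1 + w) = 1 + 2 * complex.Re w + nsq w.
Proof. by case: w => a b; rewrite /nsq ReD ImD /=; ring. Qed.

Lemma trig_bounded f : trig f -> exists C, forall t, `|f t| <= C.
Proof.
move=> [P ->]; apply: (trig_ind (Phi := fun f => exists C, forall t, `|f t| <= C)).
  move=> [a b] k; exists (`|a| + `|b|) => t; rewrite expi_exp mulcE /=.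
  apply: le_trans (ler_normB _ _) _; rewrite !normrM lerD//.
    by rewrite ler_piMr// ler_norml cos_geN1 cos_le1.
  by rewrite ler_piMr// ler_norml sin_geN1 sin_le1.
move=> g h [C gC] [D hD]; exists (C + D) => t.
by apply: le_trans (ler_normD _ _) _; exact: lerD.
Qed.

Lemma Im_trig P : trig (fun t => complex.Im P.[expi t]).
Proof.
exists (Complex 0 (-1) *: P); apply/funext => t; rewrite hornerZ.
by case: (P.[_]) => a b; rewrite mulcE /=; ring.
Qed.

Lemma nsq_poly_bounded P : exists2 C, 0 <= C & forall t, nsq P.[expi t] <= C.
Proof.
have [C HC] : exists C, forall t, `|nsq P.[expi t]| <= C.
  apply: trig_bounded; apply: trigD; apply: trigX; last exact: Im_trig.
  by exists P.
exists C; first exact: le_trans (HC 0).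
by move=> t; apply: le_trans (HC t); exact: ler_norm.
Qed.

Variable mu : {finite_measure set (measurableTypeR R) -> \bar R}.

Let mfun (f : R -> R) :=
  measurable_fun setT (f : measurableTypeR R -> measurableTypeR R).

Lemma measurable_nsq_poly P : mfun (fun t => nsq P.[expi t]).
Proof.
apply: measurable_trig; apply: trigD; apply: trigX; last exact: Im_trig.
by exists P.
Qed.

(* Q is chosen with 1 - z Q = (1 + h/n)^n, where h = (P - P(0)) / 2. *)
Lemma szego_exp P : exists Q,
  forall t, nsq (1 - expi t * Q.[expi t]) <=
    expR 1 * expR (- complex.Re P.[0]) * expR (complex.Re P.[expi t]).
Proof.
pose h := (Complex 2^-1 0)%:P * (P - P.[0]%:P).
have h0 : h.[0] = 0 by rewrite hornerM hornerD hornerN !hornerC subrr mulr0.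
have [C C0 HC] := nsq_poly_bounded h.
(* [n] exceeds a bound of |h|^2 on the circle, so |h|^2 / n^2 <= 1 / n; over n factors this costs
   [expR 1]. *)
pose n := (Num.truncn C).+1; have nC : C < n%:R by rewrite truncnS_gt.
have n0 : 0 < n%:R :> R by rewrite ltr0n.
pose H := 1 + (Complex n%:R^-1 0)%:P * h.
have : root (1 - H ^+ n) 0.
  by rewrite /root hornerD hornerN horner_exp !hornerD hornerM h0 mulr0 hornerC
    addr0 expr1n subrr.
move=> /factor_theorem[Q HQ]; exists Q => t.
have -> : 1 - expi t * Q.[expi t] = (H ^+ n).[expi t].
  have := congr1 (fun p => p.[expi t]) HQ.
  rewrite hornerD hornerN hornerC hornerM subr0 hornerX mulrC => <-.
  by rewrite opprB addrC subrK.
rewrite horner_exp nsqX -!expRD.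
(* |H|^2 = 1 + 2 Re h / n + |h|^2 / n^2 with 2 Re h = Re P - Re P(0); then 1 + x <= e^x. *)
apply: (@le_trans _ _ (expR ((1 - complex.Re P.[0] + complex.Re P.[expi t]) / n%:R) ^+ n)).
  apply: lerXn2r; rewrite ?nnegrE ?nsq_ge0 ?expR_ge0//.
  rewrite hornerD hornerC nsq1D; apply: le_trans _ (expR_ge1Dx _).
  rewrite -addrA lerD2l hornerM hornerC nsqM.
  have := HC t; rewrite {1 2}/h hornerM hornerC !nsqM hornerD hornerN hornerC.
  case: (P.[expi t]) => a b; case: (P.[0]) => c d Hh.
  rewrite [leLHS](_ : _ = (a - c) / n%:R +
    (nsq (Complex 2^-1 0) * nsq (Complex a b - Complex c d)) / n%:R ^+ 2); last first.
    by rewrite /nsq mulcE /=; field; exact: lt0r_neq0.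
  rewrite [leRHS](_ : _ = (a - c) / n%:R + 1 / n%:R); last by rewrite /=; field; exact: lt0r_neq0.
  rewrite lerD2l ler_pdivrMr ?exprn_gt0// expr2 mulrA mul1r mulVf ?mul1r ?lt0r_neq0//.
  by apply: le_trans Hh _; exact: ltW.
by rewrite -expRM_natl mulrC divfK ?lt0r_neq0.
Qed.

Hypothesis mu_angles : mu (~` angles) = 0%E.

(** For a > b, convexity gives e^b >= e^a (1 + b - a), so e^a - e^b <= e^a (a - b) <= e^M (a -
    b). *)
Lemma expR_lip (a b M : R) : a <= M -> expR a <= expR b + expR M * `|b - a|.
Proof.
move=> aM; have [ab|ba] := leP a b.
  by apply: (@le_trans _ _ (expR b)); rewrite ?ler_expR// lerDl mulr_ge0// expR_ge0.
rewrite ltr0_norm ?subr_lt0// opprB.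
have h : expR a * (1 + (b - a)) <= expR b.
  rewrite -[in leRHS](subrK a b) [in leRHS]addrC expRD.
  by rewrite ler_wpM2l ?expR_ge0// expR_ge1Dx.
have : expR a * (a - b) <= expR M * (a - b).
  by rewrite ler_wpM2r ?ler_expR// subr_ge0 ltW.
lra.
Qed.

Lemma circle_lebesgue_angles : circle_lebesgue R (~` angles) = 0%E.
Proof.
rewrite /circle_lebesgue/= /mscale/= /mrestr setIC.
by rewrite (_ : angles `&` ~` angles = set0) ?measure0 ?mule0// setICr.
Qed.

Let intZ (m : {measure set (measurableTypeR R) -> \bar R}) (k : R) (g : R -> R) :
  mfun g -> 0 <= k -> (forall t, 0 <= g t) ->
  (\int[m]_t (k%:E * (g t)%:E) = k%:E * \int[m]_t (g t)%:E)%E.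
Proof.
by move=> mg k0 g0; rewrite ge0_integralZl//;
  [exact/measurable_EFinP|move=> t _; rewrite lee_fin].
Qed.

(** [szego_exp] is applied to a trigonometric polynomial M T close to [f]. The replacement lowers
    the mean by at most 1 and raises the exponential integral by at most 1, hence 2 - K (one unit
    coming from [szego_exp]) and B + 1. *)
Lemma szego_bounded (f : R -> R) (M K B : R) : mfun f -> 0 < M ->
  (forall t, 0 <= f t <= M) ->
  (K%:E <= \int[circle_lebesgue R]_t (f t)%:E)%E ->
  (\int[mu]_t (expR (f t))%:E <= B%:E)%E ->
  exists Q, (\int[mu]_t (nsq (1 - expi t * Q.[expi t]))%:E <=
    (expR (2 - K) * (B + 1))%:E)%E.
Proof.
move=> mf M0 f0M Kf fB.
have mu_fin : fin_num_fun mu by exact: fin_num_measure.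
have [nu [nuE nu_int]] := finite_measure_add mu_fin circle_lebesgue_fin.
have nu_angles : nu (~` angles) = 0%E.
  by rewrite nuE circle_lebesgue_angles adde0; exact: mu_angles.
(* The tolerance 1 / (M e^M) yields an error e^(-M) <= 1 in the mean of M T, and M e^M / (M e^M) = 1
   in the exponential integral through [expR_lip]. *)
have [|t|_ _ /(_ (M * expR M)^-1)] := @trig_approx_bounded _ nu nu_angles (fun t => f t / M).
- by apply: measurable_funM => //; exact: measurable_cst.
- by have /andP[h1 h2] := f0M t; rewrite divr_ge0 ?(ltW M0)//= ler_pdivrMr// mul1r.
have E0 := expR_gt0 M.
rewrite invr_gt0 mulr_gt0// => -[//|T [[P HP] T01] hT].
have mT : mfun T by apply: measurable_trig; exists P.
have mD : mfun (fun t => `|f t / M - T t|).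
  apply: measurableT_comp => //; apply: measurable_funB => //.
  by apply: measurable_funM => //; exact: measurable_cst.
move: hT; rewrite nu_int//; last by apply/measurable_EFinP.
move=> hsum.
have hmu : (\int[mu]_t `|f t / M - T t|%:E < (M * expR M)^-1%:E)%E.
  by apply: le_lt_trans hsum; rewrite leeDl// integral_ge0.
have hm : (\int[circle_lebesgue R]_t `|f t / M - T t|%:E < (M * expR M)^-1%:E)%E.
  by apply: le_lt_trans hsum; rewrite leeDr// integral_ge0.
have [Q HQ] := szego_exp (Complex M 0 *: P).
have ReP x : complex.Re (Complex M 0 *: P).[x] = M * complex.Re P.[x].
  by rewrite hornerZ; case: (P.[x]) => a b; rewrite mulcE /= mul0r subr0.
exists Q.
have mexp g : mfun g -> measurable_fun setT
    (fun t : measurableTypeR R => (expR (g t))%:E).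
  by move=> mg; apply/measurable_EFinP; exact: measurableT_comp.
have mMT : mfun (fun t => M * T t).
  by apply: measurable_funM => //; exact: measurable_cst.
have mean : K - 1 <= M * complex.Re P.[0].
  rewrite -lee_fin EFinB leeBlDr//; apply: le_trans Kf _.
  apply: (@le_trans _ _ (\int[circle_lebesgue R]_t
      (M%:E * (T t)%:E + M%:E * `|f t / M - T t|%:E))%E).
    apply: ge0_le_integral => //.
    + by move=> t _; rewrite lee_fin; have /andP[] := f0M t.
    + exact/measurable_EFinP.
    + apply: emeasurable_funD; apply: measurable_funeM; exact/measurable_EFinP.
    + move=> t _; rewrite -!EFinM -EFinD lee_fin -mulrDr.
      rewrite -ler_pdivrMl// [_^-1 * _]mulrC -lerBlDl; exact: ler_norm.
  have T0 t : 0 <= T t by have /andP[] := T01 t.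
  rewrite ge0_integralD//; last 4 first.
  - by move=> t _; rewrite mule_ge0// lee_fin// ltW.
  - by apply: measurable_funeM; exact/measurable_EFinP.
  - by move=> t _; rewrite mule_ge0// lee_fin// ltW.
  - by apply: measurable_funeM; exact/measurable_EFinP.
  rewrite !intZ ?(ltW M0)//.
  have -> : (\int[circle_lebesgue R]_t (T t)%:E)%E = (complex.Re P.[0])%:E.
    by rewrite HP; apply: trig_mean => t; have := T0 t; rewrite HP.
  rewrite -EFinM leeD2l//.
  apply: (@le_trans _ _ (M%:E * (M * expR M)^-1%:E)%E).
    by rewrite lee_pmul2l// ?ltW// lte_fin.
  rewrite -EFinM lee_fin invfM mulrA divff ?gt_eqF// mul1r invf_le1//.
  by apply: le_trans _ (expR_ge1Dx _); rewrite lerDl ltW.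
have hE : (\int[mu]_t (expR (M * T t))%:E <= (B + 1)%:E)%E.
  apply: (@le_trans _ _ (\int[mu]_t
      ((expR (f t))%:E + (M * expR M)%:E * `|f t / M - T t|%:E))%E).
    apply: ge0_le_integral => //.
    + exact: mexp.
    + apply: emeasurable_funD; first exact: mexp.
      by apply: measurable_funeM; exact/measurable_EFinP.
    + move=> t _; rewrite -!EFinM -EFinD lee_fin.
      rewrite (_ : M * expR M * _ = expR M * `|f t - M * T t|).
        apply: expR_lip; rewrite -[leRHS]mulr1 ler_pM2l//; by have /andP[] := T01 t.
      rewrite [M * _]mulrC -mulrA; congr (_ * _).
      rewrite -[X in X * _](gtr0_norm M0) -normrM; congr (`|_|).
      by field; rewrite gt_eqF.
  rewrite ge0_integralD//; last 3 first.
  - exact: mexp.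
  - by move=> t _; rewrite mule_ge0// lee_fin// mulr_ge0// ltW.
  - by apply: measurable_funeM; exact/measurable_EFinP.
  rewrite intZ ?mulr_ge0 ?(ltW M0) ?(ltW E0)//.
  rewrite EFinD; apply: leeD => //.
  apply: (@le_trans _ _ ((M * expR M)%:E * (M * expR M)^-1%:E)%E).
    by rewrite lee_pmul2l// ?ltW// lte_fin mulr_gt0.
  by rewrite -EFinM divff ?lexx// gt_eqF// mulr_gt0.
apply: (@le_trans _ _ (\int[mu]_t ((expR 1 * expR (- (M * complex.Re P.[0])))%:E *
    (expR (M * T t))%:E))%E).
  apply: ge0_le_integral => //.
  + by move=> t _; rewrite lee_fin nsq_ge0.
  + apply/measurable_EFinP.
    rewrite (_ : (fun t => _) = (fun t => nsq (1 - 'X * Q).[expi t])).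
      exact: measurable_nsq_poly.
    by apply/funext => t; rewrite hornerD hornerC hornerN hornerM hornerX.
  + by apply: measurable_funeM; exact: mexp.
  + by move=> t _; rewrite -EFinM lee_fin; have := HQ t; rewrite !ReP HP.
rewrite intZ ?mulr_ge0 ?expR_ge0//; last first.
  exact: (measurableT_comp (@measurable_expR _) mMT).
have B0 : (0 <= (B + 1)%:E)%E.
  by apply: le_trans hE; apply: integral_ge0 => t _; rewrite lee_fin expR_ge0.
apply: (@le_trans _ _ ((expR 1 * expR (- (M * complex.Re P.[0])))%:E * (B + 1)%:E)%E).
  by apply: lee_wpmul2l => //; rewrite lee_fin mulr_ge0// expR_ge0.
(* By [mean], 1 - M Re P(0) <= 1 - (K - 1) = 2 - K. *)
rewrite -EFinM lee_fin ler_wpM2r// -expRD ler_expR; lra.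
Qed.

End SzegoUpperBound.

(** * Lebesgue decomposition and test functions *)

Section LebesgueDecomposition.
Context d (T : measurableType d) (R : realType).

Lemma null_dominates_measurable (m1 m2 : {measure set T -> \bar R}) :
  (forall A, measurable A -> m2 A = 0%E -> m1 A = 0%E) -> m1 `<< m2.
Proof. by move=> H N nN A mA AN; apply: H => //; exact: nN. Qed.

(** With g the density of [m] with respect to mu + m, the set S = {g = 0} is [m]-null. If m A = 0,
    then g = 0 almost everywhere on A, so A minus S is null for mu + m. Hence [mu] restricted to the
    complement of S is absolutely continuous with respect to [m], and [w] is its density. *)
Lemma lebesgue_decomposition_ex (mu m : {finite_measure set T -> \bar R}) :
  exists S (mS : measurable S) (w : T -> R),
    [/\ m S = 0%E, measurable_fun setT w, forall t, 0 <= w t &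
      forall (f : T -> \bar R) E, (forall x, (0 <= f x)%E) -> measurable E ->
        measurable_fun setT f ->
        (\int[mrestr mu (measurableC mS)]_(x in E) f x =
         \int[m]_(x in E) (f x * (w x)%:E))%E].
Proof.
have [|A mA|nu [nuE _]] := @finite_measure_add _ _ _ mu m; try exact: fin_num_measure.
have m_nu : m `<< nu.
  apply: null_dominates_measurable => A mA nA.
  have /eqP := etrans (esym (nuE A)) nA.
  by rewrite padde_eq0// => /andP[_ /eqP].
pose g := Radon_Nikodym_SigmaFinite.f m nu.
have g0 : forall x, (0 <= g x)%E by exact: Radon_Nikodym_SigmaFinite.f_ge0.
have mg : measurable_fun setT g.
  by apply: (measurable_int nu); exact: Radon_Nikodym_SigmaFinite.f_integrable.
have gE A : measurable A -> (m A = \int[nu]_(x in A) g x)%E.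
  exact: Radon_Nikodym_SigmaFinite.f_integral.
pose S := g @^-1` [set 0%E].
have mS : measurable S by rewrite -[S]setTI; exact: mg.
have m_S : m S = 0%E by rewrite gE//; apply: integral0_eq => x.
have mu_m : mrestr mu (measurableC mS) `<< m.
  apply: null_dominates_measurable => A mA mA0.
  have mgA : measurable_fun A g by exact: measurable_funTS.
  have /(ae_eq_integral_abs nu mA mgA)[N [mN nuN AN]] : (\int[nu]_(x in A) `|g x| = 0)%E.
    apply: etrans mA0; apply: etrans (esym (gE _ mA)).
    by apply: eq_integral => x _; rewrite gee0_abs.
  apply/eqP; rewrite -measure_le0 /mrestr.
  apply: (@le_trans _ _ (mu N)).
    apply: le_measure; rewrite ?inE//; first by apply: measurableI => //; exact: measurableC.
    by move=> x [Ax nSx]; apply: AN => /= /(_ Ax).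
  have /eqP := etrans (esym (nuE N)) nuN.
  by rewrite padde_eq0// => /andP[/eqP->].
pose h := Radon_Nikodym_SigmaFinite.f (mrestr mu (measurableC mS)) m.
have h_fin x : h x \is a fin_num by exact: Radon_Nikodym_SigmaFinite.f_fin_num.
have h0 x : (0 <= h x)%E by exact: Radon_Nikodym_SigmaFinite.f_ge0.
exists S, mS, (fun x => fine (h x)); split=> //.
- apply: measurableT_comp => //; apply: (measurable_int m).
  exact: Radon_Nikodym_SigmaFinite.f_integrable.
- by move=> x; rewrite fine_ge0.
move=> f E f0 mE mf.
rewrite -(Radon_Nikodym_SigmaFinite.change_of_variables mu_m)//; last exact: measurable_funTS.
by apply: eq_integral => x _; rewrite fineK.
Qed.

End LebesgueDecomposition.
(** Adding the zero measure packages [m] in the finite measure structure without changing its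
    values. *)
Lemma finite_measure_of d (T : measurableType d) (R : realType)
    (m : {measure set T -> \bar R}) : fin_num_fun m ->
  exists m' : {finite_measure set T -> \bar R}, (m' : set T -> \bar R) = m.
Proof.
move=> fm; have [//|//|nu [nuE _]] := @finite_measure_add _ _ _ m mzero.
by exists nu; apply/funext => A; rewrite [LHS]nuE /mzero adde0.
Qed.

(** * Test functions for measures outside the Szego class *)

Section TestFunctions.
Context {R : realType}.

Let mfun (f : R -> R) :=
  measurable_fun setT (f : measurableTypeR R -> measurableTypeR R).

Variables (mu : probability (measurableTypeR R) R) (hmu : class_Szc mu).

(** [class_Sz] asks for some decomposition with an integral above -oo, so outside it every
    decomposition has integral -oo. This is applied to the density [w] and the restriction of [mu]
    to [S]. *)
Lemma class_Szc_split : exists S (mS : measurable (S : set (measurableTypeR R))) (w : R -> R),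
  [/\ circle_lebesgue R S = 0%E, mfun w, forall t, 0 <= w t,
    forall f : R -> R, mfun f -> (forall t, 0 <= f t) ->
      (\int[mu]_(t in ~` S) (f t)%:E = \int[circle_lebesgue R]_t (f t * w t)%:E)%E &
    (\int[lebesgue_measure]_(t in angles) lne (w t)%:E = -oo)%E].
Proof.
have [m Em] := finite_measure_of (@circle_lebesgue_fin R).
have [S [mS [w [mS0 mw w0 hw]]]] := lebesgue_decomposition_ex mu m.
have hSm : circle_lebesgue R S = 0%E by rewrite -Em.
exists S, mS, w; split=> //.
- move=> f mf f0; rewrite -(ge0_integral_mrestr mu (measurableC mS)); last 2 first.
  + exact/measurable_EFinP.
  + by move=> t; rewrite lee_fin.
  rewrite hw//; last exact/measurable_EFinP.
  by rewrite Em; apply: eq_integral => t _; rewrite EFinM.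
case: hmu => hP hSz; apply/eqP; rewrite -leeNy_eq leNgt; apply/negP => hI.
apply: hSz; split=> //; exists w, (mrestr mu mS); split=> //; split=> //.
  exists S; split=> //.
  by apply: etrans (measure0 mu); congr (mu _); exact: setICl.
move=> A mA.
have <- : mrestr mu (measurableC mS) A = (\int[circle_lebesgue R]_(t in A) (w t)%:E)%E.
  transitivity (\int[mrestr mu (measurableC mS)]_(x in A) (cst 1%E) x)%E.
    by rewrite integral_cst// mul1e.
  rewrite hw// Em; apply: eq_integral => t _; by rewrite mul1e.
rewrite /mrestr -measureU; last 3 first.
- by apply: measurableI => //; exact: measurableC.
- exact: measurableI.
- by rewrite setIACA setICl setI0.
by rewrite -setIUr setUC setUv setIT.
Qed.

Lemma expRN_nat_le1 n : expR (- n%:R : R) <= 1.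
Proof. by rewrite -expR0 ler_expR oppr_le0. Qed.

(* The truncation at height n of the negative part of ln w, also when w = 0. *)
Definition trunc_negln (w : R -> R) (n : nat) (t : R) : R :=
  - ln (Num.min 1 (Num.max (w t) (expR (- n%:R)))).

Let trunc_gt0 (w : R -> R) n t : 0 < Num.min 1 (Num.max (w t) (expR (- n%:R))) :> R.
Proof. by rewrite lt_min ltr01 lt_max expR_gt0 orbT. Qed.

Lemma trunc_negln_itv w n t : 0 <= trunc_negln w n t <= n%:R.
Proof.
rewrite oppr_ge0 ln_le0 ?ge_min ?lexx//= lerNl -[leLHS]expRK.
by rewrite ler_ln ?posrE ?expR_gt0// le_min expRN_nat_le1 le_max lexx orbT.
Qed.

Lemma measurable_trunc_negln w n : mfun w -> mfun (trunc_negln w n).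
Proof.
move=> mw; have h : mfun (fun t => Num.min 1 (Num.max (w t) (expR (- n%:R)))).
  by apply: measurable_minr => //; apply: measurable_maxr.
by apply: measurableT_comp => //; exact: (measurableT_comp (@measurable_ln R) h).
Qed.

(** The left side is w / min(1, max(w, e^(-n))), equal to w if the minimum is 1 and at most 1
    otherwise. *)
Lemma expR_trunc_negln w n t : 0 <= w t ->
  expR (trunc_negln w n t) * w t <= 1 + w t.
Proof.
move=> w0; rewrite expRN lnK ?posrE//.
have h := trunc_gt0 w n t; rewrite mulrC ler_pdivrMr//.
have [m1|m1] := leP 1 (Num.max (w t) (expR (- n%:R))).
  by rewrite mulr1 lerDr.
rewrite (@le_trans _ _ (Num.max (w t) (expR (- n%:R))))// ?le_max ?lexx//.
by rewrite -[leLHS]mul1r ler_wpM2r ?lerDl// ltW// lt_max expR_gt0 orbT.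
Qed.

Lemma trunc_negln_nd w t : {homo trunc_negln w ^~ t : n m / (n <= m)%N >-> n <= m}.
Proof.
move=> n m nm; rewrite lerN2 ler_ln ?posrE//.
rewrite le_min ge_min lexx/= ge_min; apply/orP; right.
by rewrite ge_max le_max lexx/= le_max ler_expR lerN2 ler_nat nm orbT.
Qed.

(** Where w = 0 the truncation equals n and the limit is +oo; where w > 0 the sequence is constant
    once e^(-n) <= w. *)
Lemma cvg_trunc_negln w t : 0 <= w t ->
  (trunc_negln w n t)%:E @[n --> \oo] --> ((fun t => lne (w t)%:E)^\- t)%E.
Proof.
rewrite funenegE le_eqVlt => /predU1P[w0|w0].
  rewrite -w0 /lne lexx /= maxye.
  rewrite (_ : (fun n => _) = fun n => n%:R%:E); first by apply/cvgenyP; exact: cvg_id.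
  apply/funext => n; rewrite /trunc_negln -w0.
  rewrite (max_idPr (expR_ge0 _)) (min_idPr (expRN_nat_le1 _)).
  by rewrite expRK opprK.
rewrite lne_EFin// -EFinN -EFin_max.
have [n hn] : exists n : nat, expR (- n%:R) <= w t.
  exists (Num.truncn (- ln (w t))).+1; rewrite -[leRHS]lnK ?posrE// ler_expR.
  by rewrite lerNl ltW// truncnS_gt.
apply: cvg_near_cst; near=> k; congr (_%:E); rewrite /trunc_negln.
have -> : Num.max (w t) (expR (- k%:R)) = w t.
  apply/max_idPl; apply: le_trans hn; rewrite ler_expR lerN2 ler_nat.
  by near: k; exact: nbhs_infty_ge.
have [w1|w1] := leP (w t) 1.
  by rewrite (max_idPl _)// oppr_ge0 ln_le0.
by rewrite ln1 oppr0 (max_idPr _)// oppr_le0 ln_ge0// ltW.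
Unshelve. all: by end_near. Qed.

Lemma class_Szc_test (K : R) : exists (f : R -> R) (M : R),
  [/\ mfun f, 0 < M, forall t, 0 <= f t <= M,
    (K%:E <= \int[circle_lebesgue R]_t (f t)%:E)%E &
    (\int[mu]_t (expR (f t))%:E <= 3%:E)%E].
Proof.
have [S [mS [w [mS0 mw w0 hS hw]]]] := class_Szc_split.
have ml n := measurable_trunc_negln n mw.
have mneg : measurable_fun setT ((fun t : measurableTypeR R => lne (w t)%:E)^\-)%E.
  apply: (emeasurable_fun_cvg (fun n t => (trunc_negln w n t)%:E)).
    by move=> n; apply/measurable_EFinP; exact: ml.
  by move=> t _; exact: cvg_trunc_negln.
have cv : (\int[circle_lebesgue R]_t (trunc_negln w n t)%:E)%E @[n --> \oo] --> +oo%E.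
  have -> : +oo%E = (\int[circle_lebesgue R]_t limn (fun n => (trunc_negln w n t)%:E))%E.
    transitivity (\int[circle_lebesgue R]_t ((fun t => lne (w t)%:E)^\- t))%E; last first.
      by apply: eq_integral => t _; apply/esym/cvg_lim => //; exact: cvg_trunc_negln.
    rewrite integral_circle_lebesgue//; 
    move: hw; rewrite integralE.
    set x := (\int[_]_(_ in _) _)%E; set y := (\int[_]_(_ in _) _)%E.
    have x0 : (0 <= x)%E by exact: integral_ge0.
    have y0 : (0 <= y)%E by exact: integral_ge0.
    (* The integral of log w is x - y = -oo with x and y nonnegative, which forces y = +oo. *)
    case: y y0 => [y| |]//; last first.
      by rewrite mulry gtr0_sg ?mul1e// invr_gt0 mulr_gt0// pi_gt0.
    by case: x x0.
  apply: cvg_monotone_convergence => //.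
  - by move=> n; apply/measurable_EFinP; exact: ml.
  - by move=> n t _; rewrite lee_fin; have /andP[] := trunc_negln_itv w n t.
  - by move=> t _ n m nm; rewrite lee_fin; exact: trunc_negln_nd.
(* The level n + 1 is used because it also serves as the positive bound [M]. *)
have [n _ /(_ n.+1 (leqnSn n)) hn] : \forall n \near \oo,
    (K%:E < \int[circle_lebesgue R]_t (trunc_negln w n t)%:E)%E.
  by apply: (cv [set u | (K%:E < u)%E]); apply: open_ereal_gt'; rewrite ltry.
pose f := (trunc_negln w n.+1) \_ (~` S).
have fS t : S t -> f t = 0 by move=> St; rewrite /f patchE memNset//; exact.
have fSc t : ~ S t -> f t = trunc_negln w n.+1 t.
  by move=> St; rewrite /f patchE mem_set.
have f0 t : 0 <= f t <= n.+1%:R.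
  have [/fS ->|/fSc ->] := pselect (S t); first by rewrite lexx ler0n.
  exact: trunc_negln_itv.
have mf : mfun f.
  by apply/(measurable_restrictT _ (measurableC mS)); exact: measurable_funTS (ml _).
have mef g : mfun g -> mfun (fun t => expR (g t)).
  by move=> mg; exact: measurableT_comp.
exists f, n.+1%:R; split => //.
- apply: (@le_trans _ _ (\int[circle_lebesgue R]_t (trunc_negln w n.+1 t)%:E)%E).
    exact: ltW.
  (* [S] is null for m, so setting the function to 0 there leaves its mean unchanged. *)
  rewrite (@ge0_negligible_integral _ _ _ _ _ S)//; last 2 first.
  + apply/measurable_EFinP; exact: ml.
  + by move=> t _; rewrite lee_fin; have /andP[] := trunc_negln_itv w n.+1 t.
  rewrite [leRHS](@ge0_negligible_integral _ _ _ _ _ S)//; last 2 first.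
  + exact/measurable_EFinP.
  + by move=> t _; rewrite lee_fin; have /andP[] := f0 t.
  rewrite le_eqVlt; apply/orP; left; apply/eqP; apply: eq_integral => t.
  by rewrite inE => -[_ /fSc ->].
rewrite -(setUv S) ge0_integral_setU//; last 3 first.
- exact: measurableC.
- by rewrite setUv; apply/measurable_EFinP; exact: mef.
- by apply/disj_set2P; exact: setICr.
(* On [S], e^f = 1 contributes mu(S) <= 1. Off [S], e^f w <= 1 + w contributes at most the total
   mass of m plus mu of the complement, so at most 2. *)
have -> : 3 = 1 + 2 :> R by ring.
rewrite EFinD; apply: leeD.
  rewrite (eq_integral (cst 1%E)); last first.
    by move=> t; rewrite inE => /fS ->; rewrite expR0.
  by rewrite integral_cst// mul1e probability_le1.
rewrite (eq_integral (fun t : measurableTypeR R => (expR (trunc_negln w n.+1 t))%:E)); last first.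
  by move=> t; rewrite inE => /fSc ->.
rewrite hS; [|exact: mef|by move=> t; exact: expR_ge0].
apply: (@le_trans _ _ (\int[circle_lebesgue R]_t (1%:E + (w t)%:E))%E).
  apply: ge0_le_integral => //.
  - by move=> t _; rewrite lee_fin mulr_ge0// expR_ge0.
  - by apply/measurable_EFinP; apply: measurable_funM => //; exact: mef.
  - by apply: emeasurable_funD => //; exact/measurable_EFinP.
  - by move=> t _; rewrite -EFinD lee_fin; exact: expR_trunc_negln.
rewrite ge0_integralD//; last 2 first.
- by move=> t _; rewrite lee_fin.
- exact/measurable_EFinP.
have -> : 2 = 1 + 1 :> R by ring.
rewrite EFinD; apply: leeD.
  by rewrite integral_cst// circle_lebesgueT mul1e.
have -> : (\int[circle_lebesgue R]_t (w t)%:E = \int[mu]_(t in ~` S) cst 1 t)%E.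
  apply: etrans (esym (hS (cst 1) _ _)).
  - by apply: eq_integral => t _; rewrite mul1r.
  - exact: measurable_cst.
  - by move=> t; exact: ler01.
rewrite integral_cst ?mul1e; last exact: measurableC.
by apply: probability_le1; exact: measurableC.
Qed.

End TestFunctions.

(** * Closure in mean square *)

Section MeanSquareClosure.
Context {R : realType}.
Implicit Types (P Q : {poly R[i]}) (f g h : R -> R[i]) (E : set (R -> R[i])).

Definition cmeasurable f : Prop :=
  measurable_fun setT ((fun t => complex.Re (f t)) : measurableTypeR R -> measurableTypeR R) /\
  measurable_fun setT ((fun t => complex.Im (f t)) : measurableTypeR R -> measurableTypeR R).

Lemma cmeasurableD f g : cmeasurable f -> cmeasurable g ->
  cmeasurable (fun t => f t + g t).
Proof.
move=> [rf imf] [rg img]; split.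
  by under eq_fun do rewrite ReD; exact: measurable_funD.
by under eq_fun do rewrite ImD; exact: measurable_funD.
Qed.

Lemma cmeasurableM f g : cmeasurable f -> cmeasurable g ->
  cmeasurable (fun t => f t * g t).
Proof.
move=> [rf imf] [rg img]; split.
  rewrite (_ : (fun t => _) = fun t => complex.Re (f t) * complex.Re (g t) -
    complex.Im (f t) * complex.Im (g t)).
    by apply: measurable_funB; exact: measurable_funM.
  by apply/funext => t; case: (f t) => a b; case: (g t).
rewrite (_ : (fun t => _) = fun t => complex.Re (f t) * complex.Im (g t) +
  complex.Im (f t) * complex.Re (g t)).
  by apply: measurable_funD; exact: measurable_funM.
by apply/funext => t; case: (f t) => a b; case: (g t).
Qed.

Lemma cmeasurable_cst c : cmeasurable (fun=> c).
Proof. by split; exact: measurable_cst. Qed.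

Lemma cmeasurableB f g : cmeasurable f -> cmeasurable g ->
  cmeasurable (fun t => f t - g t).
Proof.
move=> mf mg; have := cmeasurableD mf (cmeasurableM (cmeasurable_cst (-1)) mg).
by congr cmeasurable; apply/funext => t; rewrite mulN1r.
Qed.

Lemma cmeasurable_poly P : cmeasurable (fun t => P.[expi t]).
Proof.
split; apply: measurable_trig; last exact: Im_trig.
by exists P.
Qed.

Lemma nsqD_le (z w : R[i]) : nsq (z + w) <= 2 * nsq z + 2 * nsq w.
Proof.
case: z => a b; case: w => c d; rewrite /nsq /=.
have := sqr_ge0 (a - c); have := sqr_ge0 (b - d); nra.
Qed.

Lemma nsq_expi (t : R) : nsq (expi t) = 1.
Proof. by rewrite /nsq /= cos2Dsin2. Qed.

Lemma nsq_conj (z : R[i]) : nsq z^* = nsq z.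
Proof. by case: z => a b; rewrite conjcE /nsq /= sqrrN. Qed.

Variable mu : {finite_measure set (measurableTypeR R) -> \bar R}.

(** Kept squared to avoid square roots; the triangle inequality then holds with factors 2. *)
Definition sqdist f g : \bar R := (\int[mu]_t (nsq (f t - g t))%:E)%E.

Lemma measurable_nsq f : cmeasurable f ->
  measurable_fun setT (fun t : measurableTypeR R => (nsq (f t))%:E).
Proof.
move=> [rf imf]; apply/measurable_EFinP.
by apply: measurable_funD; exact: measurable_funX.
Qed.

Lemma sqdist_trans f g h : cmeasurable f -> cmeasurable g -> cmeasurable h ->
  (sqdist f h <= 2%:E * sqdist f g + 2%:E * sqdist g h)%E.
Proof.
move=> mf mg mh; have nn (z : R[i]) : (0 <= (nsq z)%:E)%E by rewrite lee_fin nsq_ge0.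
have mm f' g' : cmeasurable f' -> cmeasurable g' ->
    measurable_fun setT (fun t : measurableTypeR R => (nsq (f' t - g' t))%:E).
  by move=> *; apply: measurable_nsq; exact: cmeasurableB.
rewrite /sqdist -!ge0_integralZl//; try exact: mm.
rewrite -ge0_integralD//; try by (apply: measurable_funeM; exact: mm).
- apply: ge0_le_integral => //; first exact: mm.
    by apply: emeasurable_funD; apply: measurable_funeM; exact: mm.
  move=> t _; rewrite -!EFinM -EFinD lee_fin.
  by rewrite (_ : f t - h t = (f t - g t) + (g t - h t)) ?nsqD_le//; ring.
- by move=> t _; rewrite mule_ge0.
- by move=> t _; rewrite mule_ge0.
Qed.

Lemma sqdistD f g f' g' : cmeasurable f -> cmeasurable g ->
  cmeasurable f' -> cmeasurable g' ->
  (sqdist (fun t => f t + f' t)%R (fun t => g t + g' t)%R <=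
   2%:E * sqdist f g + 2%:E * sqdist f' g')%E.
Proof.
move=> mf mg mf' mg'.
apply: le_trans (sqdist_trans (g := fun t => g t + f' t) _ _ _) _; try exact: cmeasurableD.
rewrite le_eqVlt; apply/orP; left; apply/eqP; congr (2%:E * _ + 2%:E * _)%E.
  by apply: eq_integral => t _; rewrite opprD addrACA subrr addr0.
by apply: eq_integral => t _; rewrite opprD addrACA subrr add0r.
Qed.

Lemma sqdistM h f g C : 0 <= C -> (forall t, nsq (h t) <= C) -> cmeasurable h ->
  cmeasurable f -> cmeasurable g ->
  (sqdist (fun t => h t * f t)%R (fun t => h t * g t)%R <= C%:E * sqdist f g)%E.
Proof.
move=> C0 hC mh mf mg; rewrite /sqdist -ge0_integralZl//; last 2 first.
- by apply: measurable_nsq; exact: cmeasurableB.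
- by move=> t _; rewrite lee_fin nsq_ge0.
apply: ge0_le_integral => //.
- by move=> t _; rewrite lee_fin nsq_ge0.
- by apply: measurable_nsq; apply: cmeasurableB; exact: cmeasurableM.
- by apply: measurable_funeM; apply: measurable_nsq; exact: cmeasurableB.
- by move=> t _; rewrite -EFinM lee_fin -mulrBr nsqM ler_wpM2r ?nsq_ge0.
Qed.

Definition csubspace E : Prop :=
  [/\ E `<=` cmeasurable,
    forall f g, E f -> E g -> E (fun t => f t + g t) &
    forall c f, E f -> E (fun t => c * f t)].

Definition msclosure E : set (R -> R[i]) :=
  [set f | cmeasurable f /\
    forall e : R, 0 < e -> exists2 g, E g & (sqdist f g < e%:E)%E].

Lemma subset_msclosure E : csubspace E -> E `<=` msclosure E.
Proof.
move=> [Em _ _] f Ef; split; first exact: Em.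
move=> e e0; exists f => //; rewrite /sqdist.
under eq_integral do rewrite subrr.
rewrite (eq_integral (cst 0%E)) ?integral0 ?lte_fin// => t _.
by rewrite /nsq /= expr0n addr0.
Qed.

(** Absorbs the factors 2 of [sqdistD] and [sqdist_trans]: two squared errors below e / 4 add up to
    less than e. *)
Let ltZ2 (x : \bar R) (e : R) : (x < (e / 4)%:E)%E -> (2%:E * x < (e / 2)%:E)%E.
Proof.
have -> : e / 2 = 2 * (e / 4) by lra.
by move=> h; rewrite EFinM lte_pmul2l// lte_fin.
Qed.

Lemma msclosureD E f g : csubspace E -> msclosure E f -> msclosure E g ->
  msclosure E (fun t => f t + g t).
Proof.
move=> [Em ED _] [mf cf] [mg cg]; split; first exact: cmeasurableD.
move=> e e0.
have [|f' Ef' ff'] := cf (e / 4); first by rewrite divr_gt0.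
have [|g' Eg' gg'] := cg (e / 4); first by rewrite divr_gt0.
exists (fun t => f' t + g' t); first exact: ED.
apply: le_lt_trans (sqdistD _ _ _ _) _ => //; try exact: Em.
by rewrite [e]splitr [X in (_ < X)%E]EFinD; apply: lteD; exact: ltZ2.
Qed.

Lemma msclosureZ E c f : csubspace E -> msclosure E f -> msclosure E (fun t => c * f t).
Proof.
move=> [Em _ EZ] [mf cf]; split; first exact: (cmeasurableM (cmeasurable_cst c)).
(* The 1 keeps the divisor positive when c = 0. *)
move=> e e0; have c0 : 0 < nsq c + 1 by rewrite ltr_wpDl ?nsq_ge0.
have [|f' Ef' ff'] := cf (e / (nsq c + 1)); first by rewrite divr_gt0.
exists (fun t => c * f' t); first exact: EZ.
have cle (t : R) : nsq c <= nsq c + 1 by rewrite lerDl.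
apply: le_lt_trans (sqdistM (ltW c0) cle (cmeasurable_cst c) mf (Em _ Ef')) _.
rewrite -[X in (_ < X%:E)%E](divfK (lt0r_neq0 c0)) [X in (_ < X%:E)%E]mulrC EFinM.
by rewrite lte_pmul2l// lte_fin.
Qed.

Lemma msclosure_idem E F f : csubspace E -> F `<=` msclosure E ->
  msclosure F f -> msclosure E f.
Proof.
move=> [Em _ _] FE [mf cf]; split=> // e e0.
have [|g Fg fg] := cf (e / 4); first by rewrite divr_gt0.
have [mg cg] := FE _ Fg.
have [|h Eh gh] := cg (e / 4); first by rewrite divr_gt0.
exists h => //; apply: le_lt_trans (sqdist_trans mf mg (Em _ Eh)) _.
by rewrite [e]splitr [X in (_ < X)%E]EFinD; apply: lteD; exact: ltZ2.
Qed.

End MeanSquareClosure.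

(** * Density of a subspace whose closure contains z^k for every integer k *)

Section Density.
Context {R : realType}.
Implicit Types (P Q : {poly R[i]}) (E : set (R -> R[i])).
Variable mu : {finite_measure set (measurableTypeR R) -> \bar R}.
Hypothesis mu_angles : mu (~` angles) = 0%E.

Let mfun (f : R -> R) :=
  measurable_fun setT (f : measurableTypeR R -> measurableTypeR R).

Let real (f : R -> R) : R -> R[i] := fun t => Complex (f t) 0.

Let nsq_real (a : R) : nsq (Complex a 0) = a ^+ 2.
Proof. by rewrite /nsq /= expr0n addr0. Qed.

Let cmeasurable_real f : mfun f -> cmeasurable (real f).
Proof. by move=> mf; split => //; exact: measurable_cst. Qed.

Variable E : set (R -> R[i]).
Hypothesis subE : csubspace E.
Hypothesis monE : forall k, msclosure mu E (fun t => expi t ^+ k).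
Hypothesis conjE : forall k, msclosure mu E (fun t => (expi t ^+ k)^*).

Let clD f g : msclosure mu E f -> msclosure mu E g ->
  msclosure mu E (fun t => f t + g t).
Proof. exact: msclosureD. Qed.

Let clZ c f : msclosure mu E f -> msclosure mu E (fun t => c * f t).
Proof. exact: msclosureZ. Qed.

Let cl_lim f : cmeasurable f ->
  (forall e : R, 0 < e -> exists2 g, msclosure mu E g & (sqdist mu f g < e%:E)%E) ->
  msclosure mu E f.
Proof. by move=> mf H; apply: (msclosure_idem (F := msclosure mu E)). Qed.

(** Re (c z^k) is half the sum of c z^k and its conjugate, both in the closure by [monE] and
    [conjE]. *)
Lemma msclosure_trig T : trig T -> msclosure mu E (real T).
Proof.
move=> [P ->]; apply: (trig_ind (Phi := fun f => msclosure mu E (real f))).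
  move=> c k.
  have := clD (clZ (Complex 2^-1 0 * c) (monE k)) (clZ (Complex 2^-1 0 * c^*) (conjE k)).
  congr msclosure; apply/funext => t; rewrite /real.
  move: c (expi t ^+ k) => [a b] [x y]; rewrite !conjcE !mulcE /=.
  by congr Complex; rewrite /=; field.
by move=> f g /clD H /H; congr msclosure; apply/funext => t; congr Complex; rewrite addr0.
Qed.

(** f / M and its approximant [T] lie in [0, 1], so |f / M - T|^2 <= |f / M - T| and approximation
    in L^1 is approximation in mean square. *)
Lemma msclosure_bounded f M : mfun f -> 0 < M -> (forall t, 0 <= f t <= M) ->
  msclosure mu E (real f).
Proof.
move=> mf M0 f0M.
have mg : mfun (fun t => f t / M).
  by apply: measurable_funM => //; exact: measurable_cst.
have g01 t : 0 <= f t / M <= 1.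
  by have /andP[h1 h2] := f0M t; rewrite divr_ge0 ?(ltW M0)//= ler_pdivrMr// mul1r.
have [_ _ ag] := trig_approx_bounded mu_angles mg g01.
have := @clZ (Complex M 0) (real (fun t => f t / M)).
rewrite (_ : (fun t => Complex M 0 * _) = real f); last first.
  apply/funext => t; rewrite /real mulcE !mul0r subr0 mulr0 addr0.
  by rewrite mulrC divfK ?lt0r_neq0.
apply; apply: cl_lim; first exact: cmeasurable_real.
move=> e /ag[T [tT T01] hT]; exists (real T); first exact: msclosure_trig.
apply: le_lt_trans hT; apply: ge0_le_integral => //.
- by move=> t _; rewrite lee_fin nsq_ge0.
- apply: measurable_nsq; apply: cmeasurableB; apply: cmeasurable_real => //.
  exact: measurable_trig.
- apply/measurable_EFinP; apply: measurableT_comp => //.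
  by apply: measurable_funB => //; exact: measurable_trig.
move=> t _; rewrite lee_fin (_ : real _ t - real T t = Complex (f t / M - T t) 0); last first.
  by rewrite /real /GRing.add /GRing.opp /=; congr Complex; rewrite subr0.
rewrite nsq_real -real_normK ?num_real// expr2 ler_piMr//.
by have := g01 t; have := T01 t; rewrite ler_norml; lra.
Qed.

(** The truncations min(f, n) converge to [f] in mean square, by dominated convergence with majorant
    f^2. *)
Lemma msclosure_ge0 f : mfun f -> (forall t, 0 <= f t) ->
  (\int[mu]_t (f t ^+ 2)%:E < +oo)%E -> msclosure mu E (real f).
Proof.
move=> mf f0 f2.
pose f_ n t := Num.min (f t) n%:R.
have mf_ n : mfun (f_ n) by exact: measurable_minr.
apply: cl_lim; first exact: cmeasurable_real.
move=> e e0.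
have [|||||_ _ cv] := @dominated_convergence _ _ _ mu setT measurableT
  (fun n t => ((f t - f_ n t) ^+ 2)%:E) (cst 0%E) (fun t => (f t ^+ 2)%:E).
- move=> n; have mfn := mf_ n; apply/measurable_EFinP; apply: measurable_funX.
  exact: measurable_funB.
- exact: measurable_cst.
- apply: aeW => t _ /=; apply: cvg_near_cst; near=> n.
  rewrite /f_ min_l ?subrr ?expr0n//.
  apply: le_trans (ltW (truncnS_gt _)) _; rewrite ler_nat.
  by near: n; exact: nbhs_infty_ge.
- apply/integrableP; split.
    by apply/measurable_EFinP; exact: measurable_funX.
  by under eq_integral do rewrite gee0_abs ?lee_fin ?sqr_ge0//.
- apply: aeW => t n _ /=; rewrite lee_fin ger0_norm ?sqr_ge0//.
  have ft := f0 t; have h : 0 <= f_ n t <= f t.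
    by rewrite /f_ le_min ft ler0n ge_min lexx.
  rewrite -[leLHS]/(_ ^+ 2) lerXn2r ?nnegrE//; lra.
rewrite integral0 in cv.
have [n _ /(_ n.+1 (leqnSn n)) hn] : \forall n \near \oo,
    (\int[mu]_t ((f t - f_ n t) ^+ 2)%:E < e%:E)%E.
  by apply: (cv [set u | (u < e%:E)%E]); apply: open_ereal_lt'; rewrite lte_fin.
exists (real (f_ n.+1)).
  apply: (@msclosure_bounded _ n.+1%:R) => // t.
  by rewrite /f_ le_min f0 ler0n ge_min lexx orbT.
rewrite /sqdist; apply: le_lt_trans hn; rewrite le_eqVlt; apply/orP; left; apply/eqP.
apply: eq_integral => t _; congr (_%:E); rewrite -nsq_real; congr nsq.
by rewrite /real /GRing.add /GRing.opp /=; congr Complex; rewrite subr0.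
Unshelve. all: by end_near. Qed.

Lemma msclosure_real f : mfun f ->
  (\int[mu]_t (f t ^+ 2)%:E < +oo)%E -> msclosure mu E (real f).
Proof.
move=> mf f2.
have le_f2 g : mfun g -> (forall t, `|g t| <= `|f t|) ->
    (\int[mu]_t (g t ^+ 2)%:E < +oo)%E.
  move=> mg gf; apply: le_lt_trans f2; apply: ge0_le_integral => //.
  - by move=> t _; rewrite lee_fin sqr_ge0.
  - by apply/measurable_EFinP; exact: measurable_funX.
  - by apply/measurable_EFinP; exact: measurable_funX.
  - move=> t _; rewrite lee_fin -[leLHS]real_normK ?num_real// -[leRHS]real_normK ?num_real//.
    by rewrite lerXn2r ?nnegrE.
pose p t := Num.max (f t) 0; pose q t := Num.max (- f t) 0.
have mp : mfun p by exact: measurable_maxr.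
have mq : mfun q by apply: measurable_maxr => //; exact: measurableT_comp.
have p0 t : 0 <= p t by rewrite le_max lexx orbT.
have q0 t : 0 <= q t by rewrite le_max lexx orbT.
have pq t : p t - q t = f t /\ `|p t| <= `|f t| /\ `|q t| <= `|f t|.
  rewrite (ger0_norm (p0 t)) (ger0_norm (q0 t)) /p /q.
  case/orP: (le_total 0 (f t)) => h.
    by rewrite max_l// max_r ?oppr_le0// subr0 ger0_norm.
  by rewrite max_r// max_l ?oppr_ge0// sub0r opprK ler0_norm// oppr_ge0.
have [cp cq] : msclosure mu E (real p) /\ msclosure mu E (real q).
  by split; apply: msclosure_ge0 => //; apply: le_f2 => // t; have [_ []] := pq t.
have := clD cp (clZ (-1) cq); congr msclosure; apply/funext => t.
rewrite mulN1r /real /GRing.add /GRing.opp /=; congr Complex; last by rewrite subr0.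
by have [] := pq t.
Qed.

Lemma msclosure_L2 f : cmeasurable f -> (\int[mu]_t (nsq (f t))%:E < +oo)%E ->
  msclosure mu E f.
Proof.
move=> mf fin; have [mre mim] := mf.
have [cr ci] : msclosure mu E (real (fun t => complex.Re (f t))) /\
    msclosure mu E (real (fun t => complex.Im (f t))).
  split; apply: msclosure_real => //; apply: le_lt_trans fin;
    apply: ge0_le_integral => //; try exact: measurable_nsq;
    try by apply/measurable_EFinP; exact: measurable_funX.
  - by move=> t _; rewrite lee_fin sqr_ge0.
  - by move=> t _; rewrite lee_fin lerDl sqr_ge0.
  - by move=> t _; rewrite lee_fin sqr_ge0.
  - by move=> t _; rewrite lee_fin lerDr sqr_ge0.
have := clD cr (clZ (Complex 0 1) ci); congr msclosure; apply/funext => t.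
rewrite /real mulcE /=; case: (f t) => a b /=; rewrite [LHS]/GRing.add /=.
by rewrite mulr0 !mul0r mul1r subrr addr0 !add0r.
Qed.

End Density.

(** * Shifted polynomials *)

Section Shift.
Context {R : realType}.
Implicit Types (P Q : {poly R[i]}).

Definition poly_multiples (N : nat) : set (R -> R[i]) :=
  [set f | exists Q, f = fun t => expi t ^+ N * Q.[expi t]].

(** The span of the monomials with exponent in [L], described by coefficients so that block
    approximants fit in directly. *)
Definition supported_polys (L : set nat) : set (R -> R[i]) :=
  [set f | exists2 P : {poly R[i]}, (forall l, P`_l != 0 -> L l) & f = fun t => P.[expi t]].

Lemma csubspace_poly_multiples N : csubspace (poly_multiples N).
Proof.
split.
- move=> _ [Q ->]; have := cmeasurable_poly ('X^N * Q); congr cmeasurable.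
  by apply/funext => t; rewrite hornerM hornerXn.
- move=> _ _ [Q ->] [Q' ->]; exists (Q + Q').
  by apply/funext => t; rewrite hornerD mulrDr.
- move=> c _ [Q ->]; exists (c *: Q).
  by apply/funext => t; rewrite hornerZ mulrCA.
Qed.

Lemma csubspace_supported_polys L : csubspace (supported_polys L).
Proof.
split.
- by move=> _ [P _ ->]; exact: cmeasurable_poly.
- move=> _ _ [P PL ->] [Q QL ->]; exists (P + Q); last first.
    by apply/funext => t; rewrite hornerD.
  move=> l; rewrite coefD; have [P0|/PL//] := eqVneq P`_l 0.
  by rewrite P0 add0r => /QL.
- move=> c _ [P PL ->]; exists (c *: P); last first.
    by apply/funext => t; rewrite hornerZ.
  by move=> l; rewrite coefZ mulf_eq0 => /norP[_ /PL].
Qed.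

Variables (mu : probability (measurableTypeR R) R).
Hypothesis hmu : class_Szc mu.

Lemma class_Szc_angles : mu (~` angles) = 0%E.
Proof.
have [[mu1 _] _] := hmu.
by rewrite probability_setC ?mu1 ?subee//; exact: measurable_angles.
Qed.

Lemma class_Szc_inf (e : R) : 0 < e ->
  exists Q, (\int[mu]_t (nsq (1 - expi t * Q.[expi t]))%:E < e%:E)%E.
Proof.
(* With B = 3 the bound e^(2 - K) (B + 1) becomes 4 (e / 8) = e / 2 < e. *)
move=> e0; pose K := 2 - ln (e / 8).
have [f [M [mf M0 f0M Kf fB]]] := class_Szc_test hmu K.
have [Q HQ] := szego_bounded class_Szc_angles mf M0 f0M Kf fB.
exists Q; apply: le_lt_trans HQ _; rewrite lte_fin /K opprB addrCA subrr addr0 lnK.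
  by lra.
by rewrite posrE divr_gt0.
Qed.

(** Induction on [N]: z^N Q is replaced by z^N Q times z S, where z S is close to 1 by
    [class_Szc_inf]. The squared error is at most the bound of |z^N Q|^2 times the integral of |1 -
    z S|^2. *)
Lemma poly_in_multiples N P : msclosure mu (poly_multiples N) (fun t => P.[expi t]).
Proof.
elim: N P => [|N IH] P.
  apply: subset_msclosure; first exact: csubspace_poly_multiples.
  by exists P; apply/funext => t; rewrite mul1r.
apply: (msclosure_idem _ _ (IH P)); first exact: csubspace_poly_multiples.
move=> _ [Q ->]; set f := fun t => _.
have mf : cmeasurable f.
  by have [+ _ _] := csubspace_poly_multiples N; apply; exists Q.
split=> // e e0.
have [C C0 HC] := nsq_poly_bounded ('X^N * Q).
have C1 : 0 < C + 1 by rewrite ltr_wpDl.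
have [|S HS] := @class_Szc_inf (e / (C + 1)); first by rewrite divr_gt0.
exists (fun t => expi t ^+ N.+1 * (S * Q).[expi t]); first by exists (S * Q).
have mS : cmeasurable (fun t => ('X * S).[expi t]) by exact: cmeasurable_poly.
have h t : nsq (f t) <= C + 1.
  by have := HC t; rewrite hornerM hornerXn /f => H; apply: le_trans H _; rewrite lerDl.
have := sqdistM mu (ltW C1) h mf (cmeasurable_cst 1) mS.
rewrite [X in (X <= _)%E](_ : _ = sqdist mu f (fun t => expi t ^+ N.+1 * (S * Q).[expi t])).
  move=> H; apply: le_lt_trans H _.
  rewrite -[X in (_ < X%:E)%E](divfK (lt0r_neq0 C1)) [X in (_ < X%:E)%E]mulrC EFinM.
  rewrite lte_pmul2l// ?lte_fin//; apply: le_lt_trans HS; rewrite le_eqVlt.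
  by apply/orP; left; apply/eqP; apply: eq_integral => t _; rewrite hornerM hornerX.
apply: eq_integral => t _; congr (nsq _)%:E; rewrite mulr1 /f !hornerM hornerX exprSr.
by congr (_ - _); ring.
Qed.

(** Multiplication by z^k is isometric and sends conj(z^k) to 1, so the distance to z^N Q equals
    that from 1 to z^(N+k) Q. *)
Lemma conj_in_multiples N k : msclosure mu (poly_multiples N) (fun t => (expi t ^+ k)^*).
Proof.
have mck : cmeasurable (fun t : R => (expi t ^+ k)^*).
  have [mr mi] := cmeasurable_poly ('X^k : {poly R[i]}); split.
    rewrite (_ : (fun t => _) = (fun t => complex.Re ('X^k).[expi t]))//.
    by apply/funext => t; rewrite hornerXn; case: (_ ^+ _).
  rewrite (_ : (fun t => _) = (fun t => - complex.Im ('X^k).[expi t])).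
    exact: measurableT_comp.
  by apply/funext => t; rewrite hornerXn; case: (_ ^+ _).
split=> // e /(proj2 (poly_in_multiples (N + k) 1))[_ [Q ->] HQ].
exists (fun t => expi t ^+ N * Q.[expi t]); first by exists Q.
apply: le_lt_trans HQ; rewrite le_eqVlt; apply/orP; left; apply/eqP.
apply: eq_integral => t _; congr (_%:E).
have ck : (expi t ^+ k)^* * expi t ^+ k = 1.
  by rewrite rmorphXn -exprMn mulrC expi_mulC expr1n.
rewrite hornerC -[RHS]mul1r -(expr1n _ k) -[in RHS](nsq_expi t) -nsqX -[in RHS]nsq_conj -nsqM.
congr nsq; rewrite mulrBr mulr1. congr (_ - _).
by rewrite exprD [X in _ * (X * _)]mulrC !mulrA ck mul1r.
Qed.

Definition near_multiple (f : R -> R[i]) N j Q : Prop :=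
  (sqdist mu f (fun t => expi t ^+ N * Q.[expi t])%R < (j.+1%:R^-1)%:E)%E.

(** Only finitely many approximants are needed for i <= j; the sum of their sizes bounds each of
    them. *)
Lemma block_size N j : exists D : nat, forall i, (i <= j)%N ->
  (exists2 Q : {poly R[i]}, (size Q <= D)%N & near_multiple (fun t => expi t ^+ i) N j Q) /\
  (exists2 Q : {poly R[i]}, (size Q <= D)%N & near_multiple (fun t => (expi t ^+ i)^*) N j Q).
Proof.
have j0 : 0 < j.+1%:R^-1 :> R by rewrite invr_gt0.
have /choice[p Hp] i : exists Q, near_multiple (fun t => expi t ^+ i) N j Q.
  have [_ /(_ _ j0)[_ [Q ->] HQ]] := poly_in_multiples N 'X^i.
  exists Q; rewrite /near_multiple; apply: le_lt_trans HQ; rewrite le_eqVlt; apply/orP.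
  by left; apply/eqP; apply: eq_integral => t _; rewrite hornerXn.
have /choice[q Hq] i : exists Q, near_multiple (fun t => (expi t ^+ i)^*) N j Q.
  by have [_ /(_ _ j0)[_ [Q ->] HQ]] := conj_in_multiples N i; exists Q.
exists (\sum_(i < j.+1) (size (p i) + size (q i)))%N => i ij.
have hi : (size (p i) + size (q i) <= \sum_(i < j.+1) (size (p i) + size (q i)))%N.
  by rewrite (bigD1 (Ordinal (ij : (i < j.+1)%N)))//= leq_addr.
split; [exists (p i)|exists (q i)] => //; apply: leq_trans hi.
  exact: leq_addr.
exact: leq_addl.
Qed.

(** * From mean squares to the L^2 norm *)

Lemma L2_normE f : cmeasurable f ->
  L2_norm mu f = ((\int[mu]_t (nsq (f t))%:E) `^ 2^-1)%E.
Proof.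
move=> mf; rewrite /L2_norm Lnorm.unlock; congr (_ `^ _)%E.
apply: eq_integral => t _; rewrite /=; congr (_%:E).
rewrite powR_mulrn ?normr_ge0// ; case: (f t) => a b.
by rewrite /= ger0_norm ?sqrtr_ge0// sqr_sqrtr// addr_ge0 ?sqr_ge0.
Qed.

Lemma L2_cmeasurable f : L2 mu f -> cmeasurable f.
Proof. by case. Qed.

Lemma L2_nsq f : L2 mu f -> (\int[mu]_t (nsq (f t))%:E < +oo)%E.
Proof.
move=> Lf; have [_ _] := Lf; rewrite (L2_normE (L2_cmeasurable Lf)).
by rewrite !ltey; apply: contraNN => /eqP ->; rewrite poweRyr// invr_eq0.
Qed.

Lemma nsq_L2 f : cmeasurable f -> (\int[mu]_t (nsq (f t))%:E < +oo)%E -> L2 mu f.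
Proof.
move=> mf; have [mr mi] := mf => fin; split=> //; rewrite L2_normE//.
by rewrite poweR_lty.
Qed.

Lemma L2_norm_lt f (e : R) : cmeasurable f -> 0 < e ->
  (\int[mu]_t (nsq (f t))%:E < (e ^+ 2)%:E)%E -> (L2_norm mu f < e%:E)%E.
Proof.
move=> mf e0; rewrite L2_normE//.
have : (0 <= \int[mu]_t (nsq (f t))%:E)%E.
  by apply: integral_ge0 => t _; rewrite lee_fin nsq_ge0.
case: (\int[mu]_t _)%E => [x| |]//; rewrite lee_fin lte_fin => x0 xe.
rewrite poweR_EFin lte_fin powR12_sqrt//.
by rewrite -(ger0_norm (ltW e0)) -sqrtr_sqr ltr_sqrt// exprn_gt0.
Qed.

Lemma L2_dense_supported (L : set nat) :
  (forall k, msclosure mu (supported_polys L) (fun t => expi t ^+ k)) ->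
  (forall k, msclosure mu (supported_polys L) (fun t => (expi t ^+ k)^*)) ->
  L2_dense mu (monomial_span L).
Proof.
move=> hm hc; split.
  move=> _ [s [c [_ ->]]].
  have -> : (fun t => \sum_(l <- s) c l * expi t ^+ l) =
    (fun t : R => (\sum_(l <- s) c l *: 'X^l).[expi t]).
    apply/funext => t; rewrite horner_sum; apply: eq_bigr => l _.
    by rewrite hornerZ hornerXn.
  apply: nsq_L2; first exact: cmeasurable_poly.
  (* Polynomials are bounded on the circle and [mu] is finite, so they lie in [L2]. *)
  have [C C0 HC] := nsq_poly_bounded (\sum_(l <- s) c l *: 'X^l).
  apply: (@le_lt_trans _ _ (\int[mu]_t cst C%:E t)%E); last first.
    rewrite integral_cst// -ge0_fin_numE ?mule_ge0// fin_numM//; exact: fin_num_measure.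
  apply: ge0_le_integral => //.
  - by move=> t _; rewrite lee_fin nsq_ge0.
  - by apply: measurable_nsq; exact: cmeasurable_poly.
  - by move=> t _; rewrite lee_fin.
move=> f Lf e e0; have mf := L2_cmeasurable Lf.
have [_ /(_ (e ^+ 2))[|_ [P PL ->] HP]] := msclosure_L2 class_Szc_angles
  (csubspace_supported_polys L) hm hc mf (L2_nsq Lf).
  by rewrite exprn_gt0.
exists (fun t => P.[expi t]); last first.
  apply: L2_norm_lt => //; apply: cmeasurableB => //; exact: cmeasurable_poly.
(* Only exponents with nonzero coefficient are listed, since those are the ones known to lie in
   [L]. *)
exists [seq l <- iota 0 (size P) | P`_l != 0], (fun l => P`_l); split.
  by move=> l; rewrite mem_filter => /andP[/PL].
apply/funext => t; rewrite horner_coef big_filter [RHS]big_mkcond/=.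
rewrite -(big_mkord xpredT (fun l => P`_l * expi t ^+ l)) /index_iota subn0.
by apply: eq_bigr => l _; case: eqP => //= ->; rewrite mul0r.
Qed.

End Shift.

(** * Exponent blocks *)

Section Blocks.
Variables (s M : nat -> nat).
Hypotheses (s0 : (0 < s 0)%N) (sM : forall j, (s j <= M j)%N)
  (sS : forall j, s j.+1 = (j.+1 * M j).+1).

(** The end [M j] is excluded, so at most [M j] exponents occur up to the end of block [j]. *)
Definition blocks : set nat := [set l | exists j, (s j <= l < M j)%N].

Let s_gt0 j : (0 < s j)%N.
Proof. by case: j => [//|j]; rewrite sS. Qed.

Let M_lt_s j k : (j < k)%N -> (M j < s k)%N.
Proof.
elim: k => // k IH; rewrite ltnS leq_eqVlt sS ltnS => /predU1P[->|/IH jk].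
  by rewrite leq_pmull.
by apply: leq_trans (ltnW jk) _; apply: leq_trans (sM k) _; rewrite leq_pmull.
Qed.

Lemma blocks_gt0 l : blocks l -> (0 < l)%N.
Proof. by move=> [j /andP[sl _]]; exact: leq_trans sl. Qed.

(** Block j + 1 starts at (j + 1) M_j + 1, so no block meets the gap from M_j to (j + 1) M_j. *)
Lemma blocks_lt j l : blocks l -> (l <= j.+1 * M j)%N -> (l < M j)%N.
Proof.
move=> [k /andP[sl lM]] lj; have [kj|jk|<-//] := ltngtP k j.
  by apply: leq_trans lM _; apply: leq_trans (ltnW (M_lt_s kj)) (sM j).
have : (s j.+1 <= s k)%N.
  move: jk; rewrite leq_eqVlt => /predU1P[<-//|/M_lt_s/ltnW/(leq_trans (sM _))]; exact.
by rewrite sS => /leq_trans /(_ sl); rewrite ltnNge lj.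
Qed.

(** At N = (j + 1) M_j only exponents below M_j are counted, so the ratio is at most 1 / (j + 1)
    along an unbounded sequence of N. *)
Lemma lower_density_blocks (R : realType) : lower_density blocks = 0 :> R.
Proof.
rewrite /lower_density; set u := fun N => _ : R.
have u0 N : 0 <= u N by rewrite divr_ge0.
have u_small j : u (j.+1 * M j)%N <= j.+1%:R^-1.
  have M0 : (0 < M j)%N by exact: leq_trans (sM j).
  rewrite /u natrM invfM mulrCA -[leRHS]mulr1 ler_pM2l ?invr_gt0//.
  rewrite ler_pdivrMr ?ltr0n// mul1r ler_nat.
  set A := (_ `&` _).
  have AM : A `<=` `I_(M j).
    by move=> l [bl /= /andP[_ lj]]; exact: blocks_lt lj.
  by apply: geq_card_fset_set; exact: subset_card_le.
have infs0 n : infs u n = 0.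
  have lb : lbound (sdrop u n) 0 by move=> _ [k _ <-].
  apply/eqP; rewrite eq_le; apply/andP; split; last first.
    by apply: lb_le_inf => //; exists (u n); exists n => /=.
  apply/ler_addgt0Pl => e e0; rewrite addr0.
  (* The first term puts the index (j + 1) M_j beyond [n], the second makes 1 / (j + 1) <= e. *)
  pose j := maxn n (Num.truncn e^-1).
  have M0 : (0 < M j)%N by exact: leq_trans (sM j).
  have nj : (n <= j.+1 * M j)%N.
    by rewrite (leq_trans (leq_maxl n (Num.truncn e^-1)))// (leq_trans (leqnSn _))// leq_pmulr.
  apply: (@le_trans _ _ (u (j.+1 * M j)%N)).
    by apply: ge_inf; [exists 0|exists (j.+1 * M j)%N].
  apply: le_trans (u_small j) _; rewrite -[leRHS]invrK lef_pV2 ?posrE ?invr_gt0//.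
  by apply: le_trans (ltW (truncnS_gt _)) _; rewrite ler_nat ltnS leq_maxr.
rewrite /limn_inf (_ : infs u = fun=> 0); last exact/funext.
by rewrite lim_cst.
Qed.

End Blocks.

(** * Construction of the exponent set *)

Theorem corollary3p4 (R : realType) (mu : probability (measurableTypeR R) R)
    (hmu : class_Szc mu) :
  exists Lambda : set nat,
    [/\ Lambda `<=` [set n | (1 <= n)%N],
        lower_density Lambda = 0 :> R
      & L2_dense mu (monomial_span Lambda)].
Proof.
have /choice[D HD] (x : nat * nat) := block_size hmu x.1 x.2.
(* The start s_(k+1) = (k + 1) M_k + 1 is written out because [M] is defined from [s]; s_0 = 1 keeps
   0 out of the exponents. [D] receives the start of the block and its precision index. *)
pose s := fix s j := if j is k.+1 then (k.+1 * (s k + D (s k, k))).+1 else 1%N.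
pose M j := (s j + D (s j, j))%N.
have sM j : (s j <= M j)%N by exact: leq_addr.
have sS j : s j.+1 = (j.+1 * M j).+1 by [].
exists (blocks s M); split.
- by move=> l; exact: blocks_gt0.
- exact: lower_density_blocks.
have supp j (Q : {poly R[i]}) : (size Q <= D (s j, j))%N ->
    supported_polys (blocks s M) (fun t : R => expi t ^+ s j * Q.[expi t]).
  move=> sQ; exists ('X^(s j) * Q).
    move=> l; rewrite coefXnM; case: ltnP => [_|sl Ql]; first by rewrite eqxx.
    (* The coefficient of z^l is that of [Q] at l - s_j, nonzero only below the size of [Q], hence l
       < M_j. *)
    exists j; rewrite sl /M -ltn_subLR//; apply: leq_trans sQ; rewrite ltnNge.
    by apply: contra Ql => /leq_sizeP/(_ _ (leqnn _)) ->.
  by apply/funext => t; rewrite hornerM hornerXn.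
have small (e : R) k : 0 < e -> exists2 j, (k <= j)%N & j.+1%:R^-1 <= e.
  move=> e0; exists (maxn k (Num.truncn e^-1)); first exact: leq_maxl.
  rewrite -[leRHS]invrK lef_pV2 ?posrE ?invr_gt0//.
  by apply: le_trans (ltW (truncnS_gt _)) _; rewrite ler_nat ltnS leq_maxr.
(* Every block j >= k approximates z^k and its conjugate within 1 / (j + 1); j is taken large enough
   for the given [e]. *)
apply: L2_dense_supported => // k; split.
- have := cmeasurable_poly ('X^k : {poly R[i]}); congr cmeasurable.
  by apply/funext => t; rewrite hornerXn.
- move=> e /(small _ k)[j kj je]; have [[Q sQ HQ] _] := HD (s j, j) k kj.
  exists (fun t => expi t ^+ s j * Q.[expi t]); first exact: supp.
  by apply: lt_le_trans HQ _; rewrite lee_fin.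
(* Only the measurability contained in membership of the closure is used here. *)
- by have [] := conj_in_multiples hmu 0 k.
- move=> e /(small _ k)[j kj je]; have [_ [Q sQ HQ]] := HD (s j, j) k kj.
  exists (fun t => expi t ^+ s j * Q.[expi t]); first exact: supp.
  by apply: lt_le_trans HQ _; rewrite lee_fin.
Qed.
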